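(* Let $(\Omega,\mathcal F,P)$ be a probability space with a filtration $(\mathcal F_t)_{t=0}^T$ such that every set in $\mathcal F_0$ has probability zero or one. For $t=0,\dots,T-1$, let $L_t:\mathbb R^N\times\mathbb R^{M^b}\times\mathbb R^{M^a}\times\Omega\to\overline{\mathbb R}$ be an $\mathcal F_{t+1}$-measurable lower bounded convex normal integrand, let $J:\mathbb R^N\times\Omega\to\overline{\mathbb R}$ be an $\mathcal F_T$-measurable lower bounded convex normal integrand, and let $$F_t(x,u^b,u^a,\omega)=A_{t+1}(\omega)x+B^b_{t+1}(\omega)u^b+B^a_{t+1}(\omega)u^a+W_{t+1}(\omega),$$ where $A_{t+1},B^b_{t+1},B^a_{t+1}$ are $\mathcal F_{t+1}$-measurable random matrices of appropriate dimensions and $W_{t+1}$ is an $\mathcal F_{t+1}$-measurable random vector in $\mathbb R^N$. Assume that, for every $t=1,\dots,T$ and almost every $\omega$, the set $$\{u\in\mathbb R^{M^a}\mid L_{t-1}^\infty(0,0,u,\omega)\le 0,\ B^a_t(\omega)u=0\}$$ is a linear subspace. Consider the problem $$(\mathrm{OC})\quad \text{minimize } E\Big[\sum_{t=0}^{T-1}L_t(X_t,U^b_t,U^a_{t+1})+J(X_T)\Big]\ \text{ over } (X,U^b,U^a)\in\mathcal N$$ $$\text{subject to } X_{t+1}=F_t(X_t,U^b_t,U^a_{t+1}),\quad t=0,\dots,T-1,\ \text{a.s.}$$ Suppose that $((J_t)_{t=0}^T,(\tilde Q_t)_{t=0}^{T-1})$ is a lower bounded convex normal solution of the Bellman equations for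 (OC). Then, for every $s=0,\dots,T$, the optimum value of (OC) equals that of $$\text{minimize } E\Big[\sum_{t=0}^{s-1}L_t(X_t,U^b_t,U^a_{t+1})+J_s(X_s)\Big]\ \text{ over } (X,U^b,U^a)\in\mathcal N^s$$ $$\text{subject to } X_{t+1}=F_t(X_t,U^b_t,U^a_{t+1}),\quad t=0,\dots,s-1,\ \text{a.s.}$$ Moreover, $(\bar X,\bar U^b,\bar U^a)\in\mathcal N$ solves (OC) if and only if, almost surely, $\bar X_0\in\operatorname{argmin}_{x_0\in\mathbb R^N}J_0(x_0)$ and, for all $t=0,\dots,T-1$, $$\bar U^b_t\in\operatorname{argmin}_{u^b\in\mathbb R^{M^b}}(E_t\tilde Q_t)(\bar X_t,u^b),$$ $$\bar U^a_{t+1}\in\operatorname{argmin}_{u^a\in\mathbb R^{M^a}}\{L_t(\bar X_t,\bar U^b_t,u^a)+J_{t+1}(F_t(\bar X_t,\bar U^b_t,u^a))\},$$ $$\bar X_{t+1}=F_t(\bar X_t,\bar U^b_t,\bar U^a_{t+1}).$$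
   Context: $\overline{\mathbb R}=[-\infty,+\infty]$. A function $h:\mathbb R^n\times\Omega\to\overline{\mathbb R}$ is a ($\mathcal G$-measurable) normal integrand if $\omega\mapsto\operatorname{epi}h(\cdot,\omega)$ is a closed-valued ($\mathcal G$-)measurable set-valued mapping, i.e. $\{\omega\mid \operatorname{epi}h(\cdot,\omega)\cap O\ne\emptyset\}$ is measurable for every open $O\subset\mathbb R^{n}\times\mathbb R$; it is convex if $h(\cdot,\omega)$ is convex for each $\omega$. It is lower bounded if there is $m\in L^1$ with $h(x,\omega)\ge m(\omega)$ for all $x\in\mathbb R^n$ and almost every $\omega$. For a random variable $x$, $h(x)$ denotes $\omega\mapsto h(x(\omega),\omega)$; the argument $\omega$ is often suppressed. For a sub-$\sigma$-algebra $\mathcal G\subset\mathcal F$, the $\mathcal G$-conditional expectation $E^{\mathcal G}h$ of a lower bounded normal integrand $h$ is the ($\mathcal G$-measurable, a.s. unique) normal integrand such that $(E^{\mathcal G}h)(x)=E[h(x)\mid\mathcal G]$ a.s. for every $\mathcal G$-measurable $\mathbb R^n$-valued random variable $x$. $E_t:=E^{\mathcal F_t}$. $\mathcal N$ is the space of adapted processes $(X_t,U^b_t,U^a_t)_{t=0}^T$, i.e. $(X_t,U^b_t,U^a_t)$ is $\mathcal F_t$-measurable with values in $\mathbb R^N\times\mathbb R^{M^b}\times\mathbb R^{M^a}$ for each $t$ (no integrability is required), and $\mathcal N^s=\{(x_t)_{t=0}^s\mid x\in\mathcal N\}$. For a lower semicontinuous convex $g:\mathbb R^n\to\overline{\mathbb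 R}$, the recession function is $g^\infty(x)=\lim_{\alpha\to\infty}\frac{g(\bar x+\alpha x)-g(\bar x)}{\alpha}$ for any $\bar x\in\operatorname{dom}g$ (whenever $g^\infty$ is written, $\operatorname{dom} g\neq\emptyset$ is understood). For a convex normal integrand, $h^\infty(\cdot,\omega)$ is the recession function of $h(\cdot,\omega)$. Sequences $(J_t)_{t=0}^T$, $(\tilde Q_t)_{t=0}^{T-1}$ of normal integrands on $\mathbb R^N\times\Omega$ and $\mathbb R^N\times\mathbb R^{M^b}\times\Omega$ are a normal solution of the Bellman equations for (OC) if, for almost every $\omega$, $J_T(\cdot,\omega)=J(\cdot,\omega)$ and, for all $t=0,\dots,T-1$, $x\in\mathbb R^N$, $u^b\in\mathbb R^{M^b}$, $$\tilde Q_t(x,u^b,\omega)=\inf_{u^a\in\mathbb R^{M^a}}\{L_t(x,u^b,u^a,\omega)+J_{t+1}(F_t(x,u^b,u^a,\omega),\omega)\},\qquad J_t(x,\omega)=\inf_{u^b\in\mathbb R^{M^b}}(E_t\tilde Q_t)(x,u^b,\omega).$$ The solution is lower bounded/convex if all $J_t$ and $\tilde Q_t$ are. Conventions: $\operatorname{argmin}f$ is the set of points where $f$ attains its infimum, and is empty if $f\equiv+\infty$; likewise, a solution of a minimization problem is a feasible point attaining the optimum value, the latter being less than $+\infty$. *)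

(* Defs.v *)
From HB Require Import structures.
From mathcomp Require Export all_boot all_order all_algebra.
From mathcomp Require Export all_classical all_reals all_analysis.
From mathcomp Require Export measurable_realfun.
Export Order.TTheory GRing.Theory Num.Theory numFieldNormedType.Exports.

Set Implicit Arguments.
Unset Strict Implicit.
Unset Printing Implicit Defensive.

Local Open Scope classical_set_scope.
Local Open Scope ring_scope.
Local Open Scope ereal_scope.

Section extended_real_functions.
Context {R : realType} {V : normedModType R}.
Implicit Types g : V -> \bar R.

Definition dom g : set V := [set x | g x < +oo].

(* [R^o] is [R] seen as a normed module over itself, so that [V * R^o] carries
   both the product topology and the vector space structure. *)
Definition epi g : set (V * R^o)%type := [set p | g p.1 <= p.2%:E].

Definition econvex g := convex_set (epi g).

Definition argmin g : set V :=
  [set x | g x = ereal_inf (range g) /\ g x < +oo].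

(* The base point is an arbitrary chosen element of [dom g]; for a proper lower
   semicontinuous convex [g] the limit does not depend on it.  When [dom g] is
   empty the value is meaningless. *)
Definition recession g (x : V) : \bar R :=
  let xbar := xget 0%R (dom g) in
  lim ((g (xbar + a *: x)%R - g xbar) * (a^-1)%:E @[a --> +oo%R]).

Definition linear_subspace (S : set V) := submod_closed [pred x | x \in S].

End extended_real_functions.

Section random_objects.
Context {d : measure_display} {Omega : measurableType d} {R : realType}.
Variable P : probability Omega R.
Implicit Types G : set (set Omega).

Definition sub_sigma_algebra_of G :=
  sigma_algebra [set: Omega] G /\ G `<=` measurable.

Definition filtration (F : nat -> set (set Omega)) (T : nat) :=
  (forall t, (t <= T)%N -> sub_sigma_algebra_of (F t)) /\
  (forall t, (t < T)%N -> F t `<=` F t.+1).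

(* Random vectors and matrices measurable from [G] to the Borel sigma-algebra. *)
Definition rv_wrt G (Y : topologicalType) (x : Omega -> Y) :=
  forall B, <<s (@open Y) >> B -> G (x @^-1` B).

Definition ext_rv_wrt G (z : Omega -> \bar R) :=
  forall B : set (\bar R), measurable B -> G (z @^-1` B).

(* [z] is a version of E[y | G], for [y] measurable and bounded below by an
   integrable random variable (so that both integrals are well defined). *)
Definition is_condexp G (y z : Omega -> \bar R) :=
  ext_rv_wrt G z /\
  forall A, G A -> \int[P]_(w in A) z w = \int[P]_(w in A) y w.

Section integrands.
Context {V : normedModType R}.
Implicit Types h k : V -> Omega -> \bar R.

Definition normal_integrand G h :=
  (forall w, closed (epi (h^~ w))) /\
  (forall O : set (V * R^o)%type, open O ->
     G [set w | epi (h^~ w) `&` O !=set0]).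

Definition convex_integrand h := forall w, econvex (h^~ w).

Definition lower_bounded h := exists m : Omega -> R,
  P.-integrable [set: Omega] (EFin \o m) /\
  {ae P, forall w, forall x, (m w)%:E <= h x w}.

(* [k] is a version of the conditional expectation E^G h of the lower bounded
   normal integrand [h]; it is determined up to a null set of [w]. *)
Definition is_condexp_integrand G h k :=
  normal_integrand G k /\
  forall x : Omega -> V, rv_wrt G x ->
    is_condexp G (fun w => h (x w) w) (fun w => k (x w) w).

End integrands.

Section optimal_control.
Context {N Mb Ma : nat}.
Local Notation state := 'cV[R]_N.
Local Notation ctrlb := 'cV[R]_Mb.
Local Notation ctrla := 'cV[R]_Ma.

(* Sequences indexed by a finite range of times are functions on [nat]; their
   values outside that range are never used. *)
Variable F : nat -> set (set Omega).
Variable L : nat -> (state * ctrlb * ctrla)%type -> Omega -> \bar R.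
Variable Fd : nat -> state -> ctrlb -> ctrla -> Omega -> state.

Definition affine_dynamics (A : nat -> Omega -> 'M[R]_N)
    (Bb : nat -> Omega -> 'M[R]_(N, Mb)) (Ba : nat -> Omega -> 'M[R]_(N, Ma))
    (W : nat -> Omega -> state)
    (t : nat) (x : state) (ub : ctrlb) (ua : ctrla) (w : Omega) : state :=
  (A t.+1 w *m x + Bb t.+1 w *m ub + Ba t.+1 w *m ua + W t.+1 w)%R.

(* Adaptedness of the truncated process (X_t, U^b_t, U^a_t), t = 0, ..., s. *)
Definition adapted (s : nat) (X : nat -> Omega -> state)
    (Ub : nat -> Omega -> ctrlb) (Ua : nat -> Omega -> ctrla) :=
  forall t, (t <= s)%N ->
    [/\ rv_wrt (F t) (X t), rv_wrt (F t) (Ub t) & rv_wrt (F t) (Ua t)].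

Definition feasible (s : nat) (X : nat -> Omega -> state)
    (Ub : nat -> Omega -> ctrlb) (Ua : nat -> Omega -> ctrla) :=
  adapted s X Ub Ua /\
  {ae P, forall w, forall t, (t < s)%N ->
    X t.+1 w = Fd t (X t w) (Ub t w) (Ua t.+1 w) w}.

(* Horizon [s] and terminal cost [K].  Under lower boundedness the integrand is
   almost surely free of -oo and has integrable negative part. *)
Definition cost (s : nat) (K : state -> Omega -> \bar R)
    (X : nat -> Omega -> state)
    (Ub : nat -> Omega -> ctrlb) (Ua : nat -> Omega -> ctrla) : \bar R :=
  \int[P]_w (\sum_(t < s) L t (X t w, Ub t w, Ua t.+1 w) w + K (X s w) w).

Definition optimum_value (s : nat) (K : state -> Omega -> \bar R) : \bar R :=
  ereal_inf [set v | exists X Ub Ua,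
    feasible s X Ub Ua /\ v = cost s K X Ub Ua].

Definition solves (s : nat) (K : state -> Omega -> \bar R)
    (X : nat -> Omega -> state)
    (Ub : nat -> Omega -> ctrlb) (Ua : nat -> Omega -> ctrla) :=
  [/\ feasible s X Ub Ua, cost s K X Ub Ua = optimum_value s K
    & cost s K X Ub Ua < +oo].

(* [EQ t] is a version of the conditional expectation E_t (Q t). *)
Definition bellman_equations (T : nat) (JT : state -> Omega -> \bar R)
    (J : nat -> state -> Omega -> \bar R)
    (Q EQ : nat -> (state * ctrlb)%type -> Omega -> \bar R) :=
  {ae P, forall w,
    (forall x, J T x w = JT x w) /\
    forall t, (t < T)%N -> forall x ub,
      Q t (x, ub) w =
        ereal_inf (range (fun ua : ctrla =>
          L t (x, ub, ua) w + J t.+1 (Fd t x ub ua w) w)) /\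
      J t x w = ereal_inf (range (fun ub' : ctrlb => EQ t (x, ub') w))}.

Definition normal_bellman_solution (T : nat) (JT : state -> Omega -> \bar R)
    (J : nat -> state -> Omega -> \bar R)
    (Q EQ : nat -> (state * ctrlb)%type -> Omega -> \bar R) :=
  [/\ forall t, (t <= T)%N -> normal_integrand measurable (J t),
      forall t, (t < T)%N -> normal_integrand measurable (Q t),
      forall t, (t < T)%N -> is_condexp_integrand (F t) (Q t) (EQ t)
    & bellman_equations T JT J Q EQ].

End optimal_control.
End random_objects.

(* Main.v *)
(* For a feasible process, L_t + J_{t+1}(X_{t+1}) >= Q_t(X_t, U^b_t) and
   E_t Q_t(X_t, U^b_t) >= J_t(X_t) almost surely, and E[E_t Q_t] = E[Q_t], so the
   cost with horizon t+1 and terminal cost J_{t+1} dominates the cost with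
   horizon t and terminal cost J_t.  Conversely, measurable selections of
   e-optimal controls extend a process from horizon t to t+1 at the price of an
   arbitrarily small increase of the cost, hence the optimum values agree.  At
   t = 0 the infimum of J_0 is almost surely constant because F_0 is trivial, and
   this constant is the common optimum value.  If it is finite, a process is
   optimal iff all the comparisons above are almost sure equalities, which is the
   pointwise argmin condition.

   Only e-optimal selections are needed, so no compactness of the level sets
   enters.  They must be measurable for the filtration, whereas J_{t+1} and Q_t
   are only measurable for the full sigma-algebra; hence J_{t+1} is replaced by
   E_{t+1} Q_{t+1}, and U^a_{t+1} is selected jointly with a near-optimal
   U^b_{t+1} and a bound on L_t. *)

Require Import Defs.
From mathcomp Require Import lra.

Set Implicit Arguments.
Unset Strict Implicit.
Unset Printing Implicit Defensive.

Local Open Scope classical_set_scope.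
Local Open Scope ring_scope.

(** * Measurability of events defined by countable quantifiers *)

Section set_comprehensions.
Context {d : measure_display} {T : measurableType d}.

Lemma measurable_ex (I : countType) (A : I -> set T) :
  (forall i, measurable (A i)) -> measurable [set w | exists i, A i w].
Proof.
move=> mA; rewrite (_ : mkset _ = \bigcup_i A i).
  exact: countable_bigcupT_measurable.
by apply/seteqP; split=> w [i]; [exists i|exists i].
Qed.

Lemma measurable_all (I : countType) (A : I -> set T) :
  (forall i, measurable (A i)) -> measurable [set w | forall i, A i w].
Proof.
move=> mA; rewrite (_ : mkset _ = ~` [set w | exists i, (~` A i) w]).
  by apply/measurableC/measurable_ex => i; exact: measurableC.
apply/seteqP; split=> w /=; first by move=> Aw [i]; apply; exact: Aw.
by move=> nA i; apply: contrapT => nAi; apply: nA; exists i.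
Qed.

Lemma measurable_prop (Q : Prop) : measurable [set _ : T | Q].
Proof.
have [q|q] := pselect Q.
  by rewrite (_ : mkset _ = setT) //; apply/seteqP; split.
by rewrite (_ : mkset _ = set0) //; apply/seteqP; split.
Qed.

End set_comprehensions.

(** * Separable normed spaces, and the vanishing sequence [invS] *)

Section separability.
Context {R : realType}.
Implicit Types V : normedModType R.

Definition separable_space V :=
  exists q : nat -> V, forall x e, 0 < e -> exists n, ball x e (q n).

Lemma separable_countType V (I : countType) (q : I -> V) :
  (forall x e, 0 < e -> exists i, ball x e (q i)) -> separable_space V.
Proof.
move=> dq; exists (fun n => if unpickle n is Some i then q i else 0) => x e e0.
by have [i xi] := dq x e e0; exists (pickle i); rewrite pickleK.
Qed.

Lemma separable_prod V1 V2 : separable_space V1 -> separable_space V2 ->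
  separable_space (V1 * V2)%type.
Proof.
move=> [q1 dq1] [q2 dq2].
apply: (@separable_countType _ (nat * nat)%type (fun i => (q1 i.1, q2 i.2))).
move=> [x y] e e0; have [i xi] := dq1 x e e0; have [j yj] := dq2 y e e0.
by exists (i, j).
Qed.

Lemma separable_matrix m n : separable_space 'M[R]_(m, n).
Proof.
apply: (@separable_countType _ 'M[rat]_(m, n) (map_mx ratr)) => x e e0.
have rat_near (y : R) : exists r : rat, ball y e (ratr r).
  have : y - e < y + e by lra.
  move=> /rat_in_itvoo[r]; rewrite in_itv/= => /andP[r1 r2].
  by exists r; rewrite /ball/= ltr_norml; lra.
have [f fP] := choice (fun ij : 'I_m * 'I_n => rat_near (x ij.1 ij.2)).
exists (\matrix_(i, j) f (i, j)); split=> // i j; rewrite !mxE.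
exact: (fP (i, j)).
Qed.

Lemma separable_real : separable_space R^o.
Proof.
apply: (@separable_countType _ rat (ratr : rat -> R^o)) => y e e0.
have : y - e < y + e by lra.
move=> /rat_in_itvoo[r]; rewrite in_itv/= => /andP[r1 r2].
by exists r; rewrite /ball/= ltr_norml; lra.
Qed.

Definition invS n : R := n.+1%:R^-1.

Lemma invS_gt0 n : 0 < invS n.
Proof. by rewrite invr_gt0. Qed.

Lemma invS_nincr m n : (m <= n)%N -> invS n <= invS m.
Proof. by move=> mn; rewrite lef_pV2 ?posrE ?ltr0n// ler_nat ltnS. Qed.

Lemma invS_lt (e : R) : 0 < e -> exists n, invS n < e.
Proof.
move=> e0; have [n _ nP] := near_infty_natSinv_lt (PosNum e0).
by exists n; apply: (nP n) => /=.
Qed.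

End separability.

(** * Compactness of bounded sets *)

Section bounded_compactness.
Context {R : realType}.

(** Heine-Borel property in a weak form: a bounded set only has to be contained in a compact one,
    which is enough to obtain cluster points. *)
Definition boundedly_compact (V : normedModType R) :=
  forall (x : V) r, exists2 K, compact K & forall y, `|x - y| <= r -> K y.

Lemma boundedly_compact_prod (V1 V2 : normedModType R) :
  boundedly_compact V1 -> boundedly_compact V2 ->
  boundedly_compact (V1 * V2)%type.
Proof.
move=> c1 c2 [x1 x2] r; have [K1 cK1 K1P] := c1 x1 r.
have [K2 cK2 K2P] := c2 x2 r.
exists (K1 `*` K2); first exact: compact_setX.
move=> [y1 y2] /=; rewrite prod_normE /= ge_max => /andP[? ?].
by split; [exact: K1P|exact: K2P].
Qed.

Lemma boundedly_compact_real : boundedly_compact R^o.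
Proof.
move=> x r; exists [set` `[(x - r : R), x + r]]; first exact: segment_compact.
by move=> y; rewrite ler_norml /= in_itv/= => ?; apply/andP; split; lra.
Qed.

(** A box of row vectors is compact as a product of segments, and the transposition, being
    continuous, carries it to column vectors. *)
Lemma boundedly_compact_colvec n : boundedly_compact 'cV[R]_n.
Proof.
move=> x r; exists (trmx @` [set v : 'rV[R]_n |
    forall i, [set` `[x i 0 - r, x i 0 + r]] (v ord0 i)]).
  have tr_cont : continuous (trmx : 'rV[R]_n -> 'cV[R]_n).
    move=> v A /nbhs_ballP[e /= e0 eA].
    apply/nbhs_ballP; exists e => //= u [_ vu]; apply: eA; split=> // i j.
    by rewrite !mxE; exact: vu.
  apply: (continuous_compact (continuous_subspaceT tr_cont)).
  apply: (@rV_compact R n (fun i => [set` `[x i 0 - r, x i 0 + r]])) => i.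
  exact: segment_compact.
move=> y /= xy; exists y^T; last by rewrite trmxK.
move=> i /=; rewrite mxE in_itv/=.
have : `|(x - y) i ord0| <= r.
  apply: le_trans xy; rewrite [leRHS]/Num.norm /= mx_normrE.
  exact: (le_bigmax _ (fun ij => `|(x - y) ij.1 ij.2|) (i, ord0)).
by rewrite !mxE ler_norml => ?; rewrite [ord0]ord1; lra.
Qed.

(** Replaces the extraction of a convergent subsequence: every neighbourhood of the cluster point is
    visited at arbitrarily late indices. *)
Lemma seq_cluster (V : topologicalType) (K : set V) (z : nat -> V) :
  compact K -> (forall m, K (z m)) ->
  exists z0 : V, forall U, nbhs z0 U ->
    forall M, exists2 m, (M <= m)%N & U (z m).
Proof.
move=> cK zK; have [|z0 [_ z0P]] := cK (z @ \oo) _.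
  by exists 0%N => //= n _; exact: zK.
exists z0 => U z0U M.
have : (z @ \oo) [set z m | m in [set m | (M <= m)%N]].
  by exists M => // m /= Mm; exists m.
by move=> /(z0P _ _) /(_ z0U)[_ [[m Mm <-] Uz]]; exists m.
Qed.

End bounded_compactness.

(** * Borel maps and random sets *)

Section borel_functions.
Context {d : measure_display} {T : measurableType d} {R : realType}.

(** Testing on open sets only spares a measurable structure on [Y]; [rv_wrtP] relates this notion to
    [rv_wrt]. *)
Definition borel_fun (Y : topologicalType) (x : T -> Y) :=
  forall O, open O -> measurable (x @^-1` O).

Lemma borel_cst (Y : topologicalType) (y : Y) : borel_fun (fun=> y).
Proof. by move=> O _; exact: measurable_prop. Qed.

Lemma borel_comp (Y Y' : topologicalType) (f : Y -> Y') (x : T -> Y) :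
  continuous f -> borel_fun x -> borel_fun (f \o x).
Proof.
by move=> /continuousP cf bx O oO; apply: (bx (f @^-1` O)); exact: cf.
Qed.

(** By separability, an open set is a countable union of balls centred in the dense sequence, with
    radii among the [invS k]. *)
Lemma borel_of_balls (Y : normedModType R) (x : T -> Y) :
  separable_space Y ->
  (forall y r, measurable (x @^-1` (ball y r))) -> borel_fun x.
Proof.
move=> [q dq] bx O oO.
rewrite (_ : _ @^-1` _ = [set w | exists nk : nat * nat,
  (ball (q nk.1) (invS nk.2) `<=` O) /\
  (x @^-1` ball (q nk.1) (invS nk.2)) w]).
  apply: measurable_ex => -[n k]; apply: measurableI; last exact: bx.
  exact: measurable_prop.
apply/seteqP; split=> w /=; last by move=> [nk [nkO xw]]; exact: nkO.
move=> Ow; have /nbhs_ballP[e /= e0 eO] := open_nbhs_nbhs (conj oO Ow).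
have [k ke] := invS_lt (divr_gt0 e0 (ltr0n R 2)).
have [n xn] := dq (x w) _ (invS_gt0 k).
exists (n, k); split; last exact: ball_sym.
move=> y ny; apply: eO.
have /le_ball : invS k + invS k <= e by lra.
by apply; exact: ball_triangle ny.
Qed.

Lemma borel_pair (Y1 Y2 : normedModType R) (x1 : T -> Y1) (x2 : T -> Y2) :
  separable_space Y1 -> separable_space Y2 ->
  borel_fun x1 -> borel_fun x2 -> borel_fun (fun w => (x1 w, x2 w)).
Proof.
move=> s1 s2 b1 b2; apply: borel_of_balls; first exact: separable_prod.
move=> [y1 y2] r; rewrite (_ : _ @^-1` _ =
  (x1 @^-1` ball y1 r) `&` (x2 @^-1` ball y2 r)) //.
by apply: measurableI; [apply: b1|apply: b2]; exact: ball_open.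
Qed.

(* Effros measurability tested on balls only. *)
Definition random_set (V : normedModType R) (D : T -> set V) :=
  forall y r, measurable [set w | D w `&` ball y r !=set0].

Lemma random_set_prod (V1 V2 : normedModType R) (D1 : T -> set V1)
    (D2 : T -> set V2) :
  random_set D1 -> random_set D2 -> random_set (fun w => D1 w `*` D2 w).
Proof.
move=> r1 r2 [y1 y2] r.
rewrite (_ : mkset _ = [set w | D1 w `&` ball y1 r !=set0] `&`
  [set w | D2 w `&` ball y2 r !=set0]); first exact: measurableI.
apply/seteqP; split=> w /=.
  by move=> [[z1 z2] [[/= D1z D2z] [/= ? ?]]]; split; [exists z1|exists z2].
by move=> [[z1 [? ?]] [z2 [? ?]]]; exists (z1, z2).
Qed.

(** The moving centre is exchanged for a dense point: [D w] meets a small ball around [q n], and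
    [y w] is close enough to [q n] for that ball to fit into the one around [y w]. *)
Lemma random_set_ball (V : normedModType R) (D : T -> set V) (y : T -> V) r :
  separable_space V -> random_set D -> borel_fun y ->
  measurable [set w | D w `&` ball (y w) r !=set0].
Proof.
move=> [q dq] rD by_.
rewrite (_ : mkset _ = [set w | exists nk : nat * nat,
  ([set w | D w `&` ball (q nk.1) (invS nk.2) !=set0] `&`
   y @^-1` ball (q nk.1) (r - invS nk.2)) w]).
  apply: measurable_ex => -[n k]; apply: measurableI; first exact: rD.
  by apply: by_; exact: ball_open.
apply/seteqP; split=> w /=; last first.
  move=> [[n k] [[p [Dp /= pn]] yn]]; exists p; split=> //.
  rewrite -(subrK (invS k) r); apply: ball_triangle pn; exact: ball_sym.
move=> [p [Dp +]]; rewrite -{1}ball_normE /= => yp.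
(* The slack is spent twice: on the distance from [p] to the dense point, and on the radius
   [r - invS k] in which [y w] must lie. *)
have [k kd] : exists k : nat, invS k < (r - `|y w - p|) / 2.
  by apply: invS_lt; lra.
have [n pn] := dq p _ (invS_gt0 k).
exists (n, k); split=> /=.
  by exists p; split => //; exact: ball_sym.
rewrite -ball_normE /= -(subrK p (q n)) -addrA.
apply: le_lt_trans (ler_normD _ _) _.
move: pn; rewrite -ball_normE /= (distrC p) (distrC p) => pn; lra.
Qed.

(** Closedness turns membership into the countably many conditions that [D w] meets every ball of
    radius [invS n] around [y w]. *)
Lemma random_set_mem (V : normedModType R) (D : T -> set V) (y : T -> V) :
  separable_space V -> random_set D -> (forall w, closed (D w)) ->
  borel_fun y -> measurable [set w | D w (y w)].
Proof.
move=> sV rD cD by_.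
rewrite (_ : mkset _ = [set w | forall n : nat,
   D w `&` ball (y w) (invS n) !=set0]).
  by apply: measurable_all => n; exact: random_set_ball.
apply/seteqP; split=> w /=.
  by move=> Dy n; exists (y w); split=> //; apply: ballxx; exact: invS_gt0.
move=> Dn; apply: cD => B /nbhs_ballP[e /= e0 eB].
have [n ne] := invS_lt e0; have [p [Dp yp]] := Dn n.
by exists p; split=> //; apply: eB; exact: le_ball (ltW ne) _ yp.
Qed.

End borel_functions.

(** * Measurable selection under a closed random constraint *)

Section measurable_selection.
Context {d : measure_display} {T : measurableType d} {R : realType}.
Context {Z V : normedModType R}.
Hypotheses (sepZ : separable_space Z) (cptZ : boundedly_compact Z)
  (sepV : separable_space V).
Variables (D : T -> set V) (Phi : Z -> T -> V).
Hypotheses (rD : random_set D) (cD : forall w, closed (D w)).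
Hypotheses (bPhi : forall z, borel_fun (Phi z))
  (cPhi : forall w, continuous (Phi ^~ w)).

(* Compactness makes the infinitely many approximate solutions of the right
   hand side accumulate at an exact one. *)
Lemma measurable_hit_balls (c : nat -> Z) (r : nat -> R) (I : set nat) :
  I 0%N ->
  measurable [set w | exists z, D w (Phi z w) /\
    forall j, I j -> `|c j - z| <= r j].
Proof.
move=> I0; have [q dq] := sepZ.
rewrite (_ : mkset _ = [set w | forall m : nat, exists i : nat,
  (forall j, I j -> `|c j - q i| <= r j + invS m) /\
  D w `&` ball (Phi (q i) w) (invS m) !=set0]).
  apply: measurable_all => m; apply: measurable_ex => i.
  by apply: measurableI; [exact: measurable_prop|exact: random_set_ball].
apply/seteqP; split=> w /=.
  move=> [z [Dz zc]] m.
  have /nbhs_ballP[e /= e0 eP] : nbhs z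
      ((Phi ^~ w) @^-1` ball (Phi z w) (invS m)).
    by apply: cPhi; apply: nbhsx_ballx; exact: invS_gt0.
  (* One dense point serves both conditions: within [e] of [z] its image is [invS m]-close to [D w],
     and within [invS m] of [z] it satisfies the relaxed ball constraints. *)
  have me0 : 0 < Num.min e (invS m) by rewrite lt_min e0 invS_gt0.
  have [i zi] := dq z _ me0.
  exists i; split.
    move=> j /zc zj; move: zi; rewrite -ball_normE /= lt_min => /andP[_ zi].
    rewrite -(subrK z (c j)) -addrA (le_trans (ler_normD _ _))//.
    by apply: lerD => //; exact: ltW.
  exists (Phi z w); split=> //; apply: ball_sym.
  by apply: eP; apply: le_ball zi; rewrite ge_min lexx.
move=> /choice[f fP].
(* The constraint of index [0], present by [I0], confines all approximate solutions to one bounded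
   set; [1] is the largest slack, [invS 0]. *)
have [K cK KP] := cptZ (c 0%N) (r 0%N + 1).
have [|z0 z0P] := @seq_cluster _ K (q \o f) cK _.
  move=> m; apply: KP; have [/(_ _ I0) + _] := fP m.
  move=> /le_trans; apply; rewrite lerD2l.
  by apply: le_trans (invS_nincr (leq0n m)) _; rewrite /invS invr1.
exists z0; split.
  apply: cD => B /nbhs_ballP[e /= e0 eB].
  have e20 : 0 < e / 2 by lra.
  have [M Me] := invS_lt e20.
  have [|m Mm /= Pm] := z0P ((Phi ^~ w) @^-1` ball (Phi z0 w) (e / 2)) _ M.
    by apply: cPhi; exact: nbhsx_ballx.
  have [_ [p [Dp pm]]] := fP m.
  exists p; split=> //; apply: eB; rewrite (splitr e).
  apply: ball_triangle Pm _; apply: le_ball pm.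
  exact: le_trans (invS_nincr Mm) (ltW Me).
move=> j Ij; apply/ler_addgt0Pr => e e0.
have e20 : 0 < e / 2 by lra.
have [M Me] := invS_lt e20.
have [|m Mm] := z0P (ball z0 (e / 2)) _ M; first exact: nbhsx_ballx.
rewrite -ball_normE /= => zm; have [/(_ _ Ij) cm _] := fP m.
have mM : invS m <= invS M :> R := invS_nincr Mm.
rewrite -(subrK (q (f m)) (c j)) -addrA (le_trans (ler_normD _ _))//.
by rewrite (distrC (q _)); lra.
Qed.

(** The space [Z] is exhausted by the balls of integer radius around the origin, each of which
    provides the single constraint of index [0]. *)
Lemma measurable_hit : measurable [set w | exists z, D w (Phi z w)].
Proof.
rewrite (_ : mkset _ = [set w | exists n : nat, exists z, D w (Phi z w) /\
    forall j, [set 0%N] j -> `|(0 : Z) - z| <= n%:R]).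
  apply: measurable_ex => n.
  exact: (measurable_hit_balls (fun=> 0) (fun=> n%:R)).
apply/seteqP; split=> w /=; last by move=> [n [z [? _]]]; exists z.
move=> [z Dz]; exists (Num.bound `|z|), z; split=> // j _.
by rewrite sub0r normrN ltW// archi_boundP.
Qed.

(* Kuratowski--Ryll-Nardzewski: greedily pick a point of the dense sequence
   close to the remaining part of the set, keeping all the previous proximity
   constraints. *)
Lemma measurable_selection : exists z : T -> Z, borel_fun z /\
  forall w, (exists z', D w (Phi z' w)) -> D w (Phi (z w) w).
Proof.
have [q dq] := sepZ.
pose e : nat -> R := @invS R.
pose near (l : seq nat) (z : Z) :=
  forall j, (j < size l)%N -> `|q (nth 0%N l j) - z| <= e j.
pose hit (l : seq nat) w := exists z, D w (Phi z w) /\ near l z.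
have mhit l : measurable [set w | hit l w].
  (* The empty list is treated apart, since the compactness argument needs a constraint of index
     [0]. *)
  case: l => [|k l].
    rewrite (_ : mkset _ = [set w | exists z, D w (Phi z w)]).
      exact: measurable_hit.
    apply/seteqP; split=> w [z]; first by move=> [? _]; exists z.
    by move=> Dz; exists z.
  exact: (measurable_hit_balls (fun j => q (nth 0%N (k :: l) j)) e
    (I := [set j | (j < size (k :: l))%N])).
have hit_next l w : hit l w -> exists k, hit (rcons l k) w.
  move=> [z [Dz lz]]; have [k zk] := dq z _ (invS_gt0 (size l)).
  exists k, z; split=> // j; rewrite size_rcons ltnS leq_eqVlt nth_rcons.
  move=> /predU1P[->|jl]; last by rewrite jl; exact: lz.
  by move: zk; rewrite ltnn eqxx -ball_normE /= distrC; exact: ltW.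
(* Taking the least admissible index makes the choice unique and expresses it through countably many
   measurable [hit] events. *)
pose least l w k := hit (rcons l k) w /\
  forall k', (k' < k)%N -> ~ hit (rcons l k') w.
pose next l w := xget 0%N [set k | least l w k].
have nextP l w : hit l w -> least l w (next l w).
  move=> /hit_next hk; apply: xgetPex.
  have hk' : exists k, `[< hit (rcons l k) w >].
    by have [k ?] := hk; exists k; exact/asboolP.
  exists (ex_minn hk'); case: ex_minnP => k /asboolP kh kmin.
  split=> // k' k'k /asboolP/kmin; rewrite leqNgt k'k //.
have least_uniq l w k k' : least l w k -> least l w k' -> k = k'.
  move=> [hk mk] [hk' mk'].
  by case: (ltngtP k k') => // [/mk'|/mk]; contradiction.
pose hist w := fix hist n :=
  if n is n'.+1 then rcons (hist n') (next (hist n') w) else [::].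
have size_hist w n : size (hist w n) = n.
  by elim: n => //= n IH; rewrite size_rcons IH.
have nth_hist w n j : (j < n)%N -> nth 0%N (hist w n) j = next (hist w j) w.
  elim: n => // n IH; rewrite ltnS leq_eqVlt /= nth_rcons size_hist.
  by move=> /predU1P[->|jn]; rewrite ?ltnn ?eqxx// jn; exact: IH.
pose E := [set w | exists z, D w (Phi z w)].
have mE : measurable E := measurable_hit.
have hit_hist w n : E w -> hit (hist w n) w.
  move=> [z Dz]; elim: n => [|n /nextP[] //]; by exists z.
have mhist l : measurable (E `&` [set w | hist w (size l) = l]).
  elim/last_ind: l => [|l k IH].
    rewrite (_ : _ `&` _ = E) //; by apply/seteqP; split=> w // [].
  rewrite (_ : _ `&` _ = (E `&` [set w | hist w (size l) = l]) `&`
     ([set w | hit (rcons l k) w] `&`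
      [set w | forall k' : nat, ~ ((k' < k)%N /\ hit (rcons l k') w)])).
    apply: measurableI => //; apply: measurableI => //.
    apply: measurable_all => k'; apply: measurableC.
    by apply: measurableI; [exact: measurable_prop|exact: mhit].
  apply/seteqP; split=> w /=; rewrite size_rcons /=.
    move=> [Ew /rcons_inj[hl hk]]; rewrite hl in hk.
    have := hit_hist w (size l) Ew.
    rewrite hl => /nextP; rewrite hk => -[h1 h2].
    by split=> //; split=> // k' [/h2].
  move=> [[Ew hl] [hk mk]]; split=> //; rewrite hl; congr rcons.
  apply: (@least_uniq l w); last by split=> // k' k'k h; exact: (mk k').
  by apply: nextP; rewrite -{1}hl; exact: hit_hist.
(* Since [e j] tends to zero, these constraints leave room for a single point, the limit of the
   chosen dense points. *)
pose lim_pt w z := D w (Phi z w) /\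
  forall j, `|q (next (hist w j) w) - z| <= e j.
have lim_ex w : E w -> exists z, lim_pt w z.
  move=> Ew; have /choice[f fP] :
      forall n, exists z, D w (Phi z w) /\ near (hist w n) z.
    by move=> n; exact: hit_hist.
  have [K cK KP] := cptZ (q (next (hist w 0%N) w)) 1.
  have [|z0 z0P] := @seq_cluster _ K (fun n => f n.+1) cK _.
    move=> n; apply: KP; have [_ /(_ 0%N)] := fP n.+1.
    rewrite size_hist nth_hist // => /(_ isT); rewrite /e /invS invr1; exact.
  exists z0; split.
    apply: cD => B zB; have [m _ Bm] := z0P _ (cPhi zB) 0%N.
    by exists (Phi (f m.+1) w); split=> //; have [] := fP m.+1.
  move=> j; apply/ler_addgt0Pr => x x0.
  have [|m jm] := z0P (ball z0 x) _ j; first exact: nbhsx_ballx.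
  rewrite -ball_normE /= => zm; have [_ /(_ j)] := fP m.+1.
  rewrite size_hist nth_hist ltnS // => /(_ jm) cm.
  rewrite -(subrK (f m.+1) (q _)) -addrA (le_trans (ler_normD _ _))//.
  by apply: lerD => //; rewrite distrC ltW.
(* Outside [E] the selection takes the default value [0], which accounts for the first set in the
   preimage below. *)
pose z w := if pselect (E w) is left Ew then sval (cid (lim_ex w Ew)) else 0.
have zE w : E w -> lim_pt w (z w).
  by rewrite /z; case: pselect => // Ew _; exact: svalP (cid (lim_ex w Ew)).
exists z; split; last by move=> w /zE[].
move=> O oO.
(* On [E], membership in the open set [O] is decided by a finite history: some closed ball imposed
   by it already lies in [O]. *)
rewrite (_ : _ @^-1` _ = [set w | ~ E w /\ O (0 : Z)] `|`
  [set w | exists lk : seq nat * nat,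
    [set _ : T | forall y, `|q lk.2 - y| <= e (size lk.1) -> O y] w /\
    (E `&` [set w | hist w (size (rcons lk.1 lk.2)) = rcons lk.1 lk.2]) w]).
  apply: measurableU.
    apply: measurableI; [exact: measurableC|exact: measurable_prop].
  apply: measurable_ex => lk; apply: measurableI; last exact: mhist.
  exact: measurable_prop.
apply/seteqP; split=> w /=; last first.
  move=> [[nE O0]|]; first by rewrite /z; case: pselect.
  move=> [[l k] /= [lkO [Ew]]]; rewrite size_rcons /= => /rcons_inj[hl hk].
  by have [_ /(_ (size l))] := zE w Ew; rewrite hk; exact: lkO.
move=> Oz; have [Ew|nE] := pselect (E w); last first.
  by left; split=> //; move: Oz; rewrite /z; case: pselect.
right; have [_ zn] := zE w Ew.
have /nbhs_ballP[r /= r0 rO] := open_nbhs_nbhs (conj oO Oz).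
have [n nr] := invS_lt (divr_gt0 r0 (ltr0n R 2)).
exists (hist w n, next (hist w n) w) => /=; split; last first.
  by split=> //; rewrite size_rcons size_hist.
rewrite size_hist => y yn; apply: rO; rewrite -ball_normE /=.
rewrite -(subrK (q (next (hist w n) w)) (z w)) -addrA.
apply: le_lt_trans (ler_normD _ _) _.
by have := zn n; rewrite distrC; move: yn; rewrite /e; lra.
Qed.

End measurable_selection.

(** * Measurable near-optimal selection *)

Section near_optimal_selection.
Context {d : measure_display} {T : measurableType d} {R : realType}.
Context {Z V : normedModType R}.
Hypotheses (sepZ : separable_space Z) (cptZ : boundedly_compact Z)
  (sepV : separable_space V).
Variables (D : T -> set V) (Phi : R -> Z -> T -> V).
Hypotheses (rD : random_set D) (cD : forall w, closed (D w)).
Hypotheses (bPhi : forall a z, borel_fun (Phi a z))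
  (cPhi : forall a w, continuous (Phi a ^~ w)).
Hypothesis D_mono : forall a a' z w,
  a <= a' -> D w (Phi a z w) -> D w (Phi a' z w).

(* The level sets are only explored on the grid of multiples of [e], which
   avoids measurability of the value function. *)
Lemma near_optimal_selection (e : R) : 0 < e -> exists z : T -> Z,
  borel_fun z /\
  forall w (v : Z -> \bar R) (j : R),
    (forall a z', D w (Phi a z' w) -> (v z' <= a%:E)%E) ->
    (forall z', (j%:E <= v z')%E) ->
    (forall a, j < a -> exists z', D w (Phi a z' w)) ->
    (v (z w) <= (j + e)%:E)%E.
Proof.
move=> e0.
(* [D w (Phi a z w)] reads: [z] certifies a value at most [a]. The certificate is sought here at the
   grid level [k * e]. *)
pose hit (k : int) := [set w | exists z, D w (Phi (k%:~R * e) z w)].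
have hit_mono k k' w : k <= k' -> hit k w -> hit k' w.
  move=> kk' [z Dz]; exists z; apply: D_mono Dz.
  by rewrite ler_pM2r// ler_int.
have mhit k : measurable (hit k) by exact: (@measurable_hit _ _ _ _ _ sepZ).
have /choice[zs zsP] (k : int) := measurable_selection sepZ cptZ sepV rD cD
  (@bPhi (k%:~R * e)) (@cPhi (k%:~R * e)).
(* By monotonicity in the level, at most one [k] is the first successful one. Where there is none,
   the default index [0] is used below. *)
pose first k := hit k `\` hit (k - 1).
have mfirst k : measurable (first k) by exact: measurableD.
have first_uniq k k' w : first k w -> first k' w -> k = k'.
  have aux (i j : int) : first i w -> first j w -> ~ i < j.
    move=> [hi _] [_ nj] ij; apply: nj; apply: hit_mono hi.
    by rewrite lerBrDr -ltzD1 ltrD2r.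
  move=> fk fk'; case: (ltgtP k k') => //.
    by move=> /(aux _ _ fk fk').
  by move=> /(aux _ _ fk' fk).
pose k w := xget 0 [set k | first k w].
have kE i w : first i w -> k w = i.
  move=> fi; apply: (first_uniq _ _ w _ fi).
  exact: (@xgetI _ 0 [set k | first k w] i fi).
exists (fun w => zs (k w) w); split.
  move=> O oO.
  rewrite (_ : _ @^-1` _ = [set w | exists i, (first i `&` zs i @^-1` O) w] `|`
    ([set w | forall i, (~` first i) w] `&` zs 0 @^-1` O)).
    apply: measurableU.
      by apply: measurable_ex => i; apply: measurableI => //; exact: (zsP i).1.
    apply: measurableI; last exact: (zsP 0).1.
    by apply: measurable_all => i; exact: measurableC.
  apply/seteqP; split=> w /=.
    move=> Oz; have [[i fi]|nf] := pselect (exists i, first i w).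
      by left; exists i; split=> //; rewrite -(kE i w fi).
    have nf' i : ~ first i w by move=> fi; apply: nf; exists i.
    right; split=> //; move: Oz; rewrite /k xgetPN //.
  move=> [[i [fi Oz]]|[nf Oz]]; first by rewrite (kE i w fi).
  by rewrite /k xgetPN.
move=> w v j vle jle hitj.
have lb a z : D w (Phi a z w) -> j <= a.
  by move=> /vle; rewrite -lee_fin; exact: le_trans.
have [z0 Dz0] := hitj (j + 1) (ltr_pwDr ltr01 (lexx j)).
have [i0 hi0] : exists i, hit i w.
  exists (Num.ceil ((j + 1) / e)), z0; apply: D_mono Dz0.
  by rewrite -ler_pdivrMr//; exact: Num.Theory.ceil_ge.
(* Without a first level, success would propagate down to every grid level, and so below the lower
   bound [j]. *)
have [i fi] : exists i, first i w.
  apply: contrapT => nf.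
  have hit_all (n : nat) : hit (i0 - n%:Z) w.
    elim: n => [|n IH]; first by rewrite subr0.
    apply: contrapT => nh; apply: nf; exists (i0 - n%:Z); split=> //.
    by move: nh; rewrite intS (addrC 1) opprD addrA.
  pose n := Num.bound `|i0%:~R - j / e|.
  have [z /lb] := hit_all n.
  rewrite -ler_pdivrMr// leNgt => /negP; apply.
  have : i0%:~R - j / e < n%:R.
    exact: le_lt_trans (ler_norm _) (archi_boundP (normr_ge0 _)).
  by rewrite intrB /= -[n%:~R]/(n%:R); lra.
rewrite (kE i w fi); have /vle/le_trans := (zsP i).2 w fi.1; apply.
(* If [i * e] exceeded [j + e], the preceding grid level would still exceed [j] and be successful,
   against the choice of [i]. *)
rewrite lee_fin leNgt; apply/negP => lt_j.
have [z Dz] : exists z, D w (Phi ((i - 1)%:~R * e) z w).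
  by apply: hitj; rewrite intrB mulrBl mul1r ltrBrDr.
by apply: fi.2; exists z.
Qed.

End near_optimal_selection.

(** * Normal integrands evaluated at random points *)

Section integrands.
Context {d : measure_display} {T : measurableType d} {R : realType}.
Local Open Scope ereal_scope.

Lemma emeasurable_fun_sublevel (f : T -> \bar R) :
  (forall r : R, measurable [set w | f w <= r%:E]) -> measurable_fun setT f.
Proof.
move=> mf; apply: (measurability _ (ErealGenOInfty.measurableE R)).
move=> _ [_ [r ->] <-]; rewrite setTI.
rewrite (_ : _ @^-1` _ = ~` [set w | f w <= r%:E]); first exact: measurableC.
apply/seteqP; split=> w /=; rewrite in_itv/= andbT ltNge; first by move/negP.
by move=> ?; apply/negP.
Qed.

Lemma normal_random_set (V : normedModType R) (h : V -> T -> \bar R) :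
  normal_integrand measurable h -> random_set (fun w => epi (h ^~ w)).
Proof. by move=> [_ mh] y r; apply: mh; exact: ball_open. Qed.

(** [h (x w) w <= r] says that the pair [(x w, r)] lies in the closed random set [epi], so
    [random_set_mem] handles every sublevel event. *)
Lemma measurable_normal_integrand (V : normedModType R) (h : V -> T -> \bar R)
    (x : T -> V) : separable_space V ->
  normal_integrand measurable h -> borel_fun x ->
  measurable_fun setT (fun w => h (x w) w).
Proof.
move=> sV nh bx; apply: emeasurable_fun_sublevel => r.
apply: (@random_set_mem _ _ R (V * R^o)%type (fun w => epi (h ^~ w))
  (fun w => (x w, r : R^o))).
- exact: separable_prod separable_real.
- exact: normal_random_set.
- exact: nh.1.
- by apply: borel_pair => //; [exact: separable_real|exact: borel_cst].
Qed.

End integrands.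

(** * Continuity of matrix operations and of the dynamics *)

Section continuity.
Context {R : realType}.

Lemma pair_continuous (X Y Y' : topologicalType) (f : X -> Y) (g : X -> Y') :
  continuous f -> continuous g -> continuous (fun x => (f x, g x)).
Proof. by move=> cf cg x; apply: cvg_pair; [exact: cf|exact: cg]. Qed.

Lemma fst_continuous (X Y : topologicalType) : continuous (@fst X Y).
Proof. by move=> x; exact: cvg_fst. Qed.

Lemma snd_continuous (X Y : topologicalType) : continuous (@snd X Y).
Proof. by move=> x; exact: cvg_snd. Qed.

Lemma comp_continuous (X Y Y' : topologicalType) (f : X -> Y) (g : Y -> Y') :
  continuous f -> continuous g -> continuous (g \o f).
Proof. by move=> cf cg x; apply: continuous_comp; [exact: cf|exact: cg]. Qed.

Lemma matrix_continuous (X : topologicalType) m n (f : X -> 'M[R]_(m, n)) :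
  (forall i j, continuous (fun x => f x i j)) -> continuous f.
Proof.
move=> cf x; apply/cvg_ballP => e e0.
suff : \forall y \near x, forall i j, ball (f x i j) e (f y i j).
  by apply: filterS => y; split.
apply: filter_forall => i; apply: filter_forall => j.
by have /cvg_ballP := cf i j x; exact.
Qed.

Lemma mulmx_continuous m n p :
  continuous (fun AB : 'M[R]_(m, n) * 'M[R]_(n, p) => AB.1 *m AB.2).
Proof.
apply: matrix_continuous => i j; under eq_fun do rewrite mxE.
apply: continuous_big => [|k _]; first exact: add_continuous.
have cA := comp_continuous (@fst_continuous 'M[R]_(m, n) 'M[R]_(n, p))
  (@coord_continuous R m n i k).
have cB := comp_continuous (@snd_continuous 'M[R]_(m, n) 'M[R]_(n, p))
  (@coord_continuous R n p k j).
move=> x; exact: continuousM (cA x) (cB x).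
Qed.

Lemma affine_dynamics_continuous (d : measure_display)
    (Omega : measurableType d) (N Mb Ma : nat)
    (A : nat -> Omega -> 'M[R]_N)
    (Bb : nat -> Omega -> 'M[R]_(N, Mb)) (Ba : nat -> Omega -> 'M[R]_(N, Ma))
    (W : nat -> Omega -> 'cV[R]_N) t x ub w :
  continuous (fun ua => affine_dynamics A Bb Ba W t x ub ua w).
Proof.
have cBa : continuous (fun ua : 'cV[R]_Ma => Ba t.+1 w *m ua).
  apply: (@comp_continuous _ ('M[R]_(N, Ma) * 'cV[R]_Ma)%type _
    (fun ua => (Ba t.+1 w, ua)) (fun AB => AB.1 *m AB.2)).
    apply: pair_continuous; first exact: cst_continuous.
    by move=> z; exact: cvg_id.
  exact: mulmx_continuous.
by move=> ua; exact: (cvgD (cvgD (cvg_cst _) (cBa ua)) (cvg_cst _)).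
Qed.

End continuity.

(** * Random vectors measurable for a sub-sigma-algebra *)

Section random_vectors.
Context {d : measure_display} {Omega : measurableType d} {R : realType}.
Implicit Types G : set (set Omega).

(** The sets whose preimage is in [G] form a sigma-algebra, so open sets suffice. Seeing [Omega] as
    a measurable space for [G] makes the selection results available for each [F t]. *)
Lemma rv_wrtP G (Y : topologicalType) (x : Omega -> Y) :
  sigma_algebra setT G ->
  rv_wrt G x <-> borel_fun (T := g_sigma_algebraType G) x.
Proof.
move=> sG; rewrite /borel_fun measurable_g_measurableTypeE //; split.
  by move=> rx O oO; apply: rx; exact: sub_sigma_algebra.
move=> bx B; apply: (smallest_sub (X := [set B | G (x @^-1` B)])) => //.
have [G0 GC GU] := sG; split=> /=.
- by rewrite preimage_set0.
- by move=> C GxC; rewrite setTD preimage_setC -setTD; exact: GC.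
- by move=> C GxC; rewrite preimage_bigcup; exact: GU.
Qed.

Lemma rv_wrt_sub G G' (Y : topologicalType) (x : Omega -> Y) :
  G `<=` G' -> rv_wrt G x -> rv_wrt G' x.
Proof. by move=> GG' rx B /rx/GG'. Qed.

Lemma rv_wrt_borel G (Y : topologicalType) (x : Omega -> Y) :
  G `<=` measurable -> rv_wrt G x -> borel_fun x.
Proof. by move=> Gm rx O oO; apply/Gm/rx; exact: sub_sigma_algebra. Qed.

Lemma rv_wrt_pair G (Y1 Y2 : normedModType R) (x1 : Omega -> Y1)
    (x2 : Omega -> Y2) : sigma_algebra setT G ->
  separable_space Y1 -> separable_space Y2 ->
  rv_wrt G x1 -> rv_wrt G x2 -> rv_wrt G (fun w => (x1 w, x2 w)).
Proof.
move=> sG s1 s2 /(rv_wrtP _ sG) r1 /(rv_wrtP _ sG) r2.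
by apply/(rv_wrtP _ sG); exact: borel_pair.
Qed.

Lemma rv_wrt_comp G (Y Y' : topologicalType) (f : Y -> Y') (x : Omega -> Y) :
  sigma_algebra setT G -> continuous f -> rv_wrt G x -> rv_wrt G (f \o x).
Proof.
by move=> sG cf /(rv_wrtP _ sG) rx; apply/(rv_wrtP _ sG); exact: borel_comp.
Qed.

Lemma rv_wrt_cst G (Y : topologicalType) (y : Y) :
  sigma_algebra setT G -> rv_wrt G (fun=> y).
Proof. by move=> sG; apply/(rv_wrtP _ sG); exact: borel_cst. Qed.

Lemma rv_wrt_mulmx G m n p (A : Omega -> 'M[R]_(m, n))
    (B : Omega -> 'M[R]_(n, p)) : sigma_algebra setT G ->
  rv_wrt G A -> rv_wrt G B -> rv_wrt G (fun w => A w *m B w).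
Proof.
move=> sG rA rB; apply: (@rv_wrt_comp G _ _
  (fun AB : 'M[R]_(m, n) * 'M[R]_(n, p) => AB.1 *m AB.2)
  (fun w => (A w, B w)) sG); first exact: mulmx_continuous.
by apply: rv_wrt_pair => //; exact: separable_matrix.
Qed.

Lemma rv_wrt_add G m n (A B : Omega -> 'M[R]_(m, n)) : sigma_algebra setT G ->
  rv_wrt G A -> rv_wrt G B -> rv_wrt G (fun w => A w + B w).
Proof.
move=> sG rA rB; apply: (@rv_wrt_comp G _ _
  (fun AB : 'M[R]_(m, n) * 'M[R]_(m, n) => AB.1 + AB.2)
  (fun w => (A w, B w)) sG); first exact: add_continuous.
by apply: rv_wrt_pair => //; exact: separable_matrix.
Qed.

Lemma normal_integrand_g_sigma G (V : normedModType R)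
    (h : V -> Omega -> \bar R) : sigma_algebra setT G ->
  normal_integrand G h ->
  random_set (T := g_sigma_algebraType G) (fun w => epi (h ^~ w)).
Proof.
move=> sG [_ mh] y r; rewrite measurable_g_measurableTypeE //.
by apply: mh; exact: ball_open.
Qed.

Lemma normal_integrand_sub G G' (V : normedModType R)
    (h : V -> Omega -> \bar R) : G `<=` G' ->
  normal_integrand G h -> normal_integrand G' h.
Proof. by move=> GG' [ch mh]; split=> // O /mh/GG'. Qed.

End random_vectors.

Local Open Scope ereal_scope.

(** * Integrals of functions with an integrable minorant *)

Section minorized_functions.
Context {d : measure_display} {T : measurableType d} {R : realType}.
Variable mu : {measure set T -> \bar R}.
Implicit Types f g : T -> \bar R.

(** The negative part is integrable, so integrals are never [-oo] and remain monotone and additive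
    even when they equal [+oo]. *)
Definition minorized f := measurable_fun setT f /\
  exists m : T -> R, mu.-integrable setT (EFin \o m) /\
    {ae mu, forall w, (m w)%:E <= f w}.

Lemma minorized_negpart f : minorized f -> \int[mu]_w f^\- w < +oo.
Proof.
move=> [mf [m [/integrableP[mm im] mle]]]; apply: le_lt_trans im.
apply: ae_ge0_le_integral => //.
- exact: measurable_funeneg.
- exact: measurableT_comp.
apply: filterS mle => w mw _; rewrite !funenegE ge_max abse_ge0 andbT /=.
apply: le_trans (_ : - (m w)%:E <= _); first by rewrite leeN2.
by rewrite -EFinN lee_fin -normrN ler_norm.
Qed.

(** The negative part has a finite integral already, so an integral below [+oo] bounds the positive
    part as well. *)
Lemma minorized_integrable f : minorized f -> \int[mu]_w f w < +oo ->
  mu.-integrable setT f.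
Proof.
move=> mf; have := minorized_negpart mf; have [mf' _] := mf.
have neg0 : 0 <= \int[mu]_w f^\- w by exact: integral_ge0.
have pos0 : 0 <= \int[mu]_w f^\+ w by exact: integral_ge0.
rewrite [in X in _ -> X -> _]integralE => neg_fin fin.
have pos_fin : \int[mu]_w f^\+ w < +oo.
  move: neg0 neg_fin fin pos0; case: (\int[mu]_w f^\- w) => // r _ _.
  by case: (\int[mu]_w f^\+ w) => // s _ _; exact: ltry.
apply/integrableP; split=> //.
under eq_integral do rewrite -[`|f _|]/((abse \o f) _) fune_abse.
rewrite ge0_integralD//; [|exact: measurable_funepos|exact: measurable_funeneg].
exact: lte_add_pinfty.
Qed.

Lemma minorized_integral_gtNy f : minorized f -> -oo < \int[mu]_w f w.
Proof.
move=> mf; have := minorized_negpart mf.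
have : 0 <= \int[mu]_w f^\- w by exact: integral_ge0.
have : 0 <= \int[mu]_w f^\+ w by exact: integral_ge0.
rewrite [X in _ -> _ -> _ -> _ < X]integralE.
by case: (\int[mu]_w f^\+ w) => //= r _; case: (\int[mu]_w f^\- w) => // s _ _;
  rewrite -EFinN ?addye// -EFinD ltNyr.
Qed.

Lemma minorized_gtNy f : minorized f -> {ae mu, forall w, -oo < f w}.
Proof.
by move=> [_ [m [_]]]; apply: filterS => w; apply: lt_le_trans; exact: ltNyr.
Qed.

Lemma minorizedD f g : minorized f -> minorized g -> minorized (f \+ g).
Proof.
move=> [mf [m [im mf_le]]] [mg [n [i_n ng_le]]].
split; first exact: emeasurable_funD.
exists (m \+ n)%R; split; first exact: (integrableD measurableT im i_n).
by apply: filterS2 mf_le ng_le => w mw nw; rewrite /= EFinD leeD.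
Qed.

Lemma minorized_sum (I : Type) (s : seq I) (f : I -> T -> \bar R) :
  (forall i, minorized (f i)) -> minorized (fun w => \sum_(i <- s) f i w).
Proof.
move=> mf; elim: s => [|i s IH].
  rewrite (_ : (fun w => _) = cst 0); last first.
    by apply/funext => w; rewrite big_nil.
  split; first exact: measurable_cst.
  exists (cst 0%R); split; first exact: integrable0.
  by apply: aeW => w.
rewrite (_ : (fun w => _) = f i \+ (fun w => \sum_(j <- s) f j w)).
  exact: minorizedD.
by apply/funext => w; rewrite big_cons.
Qed.

Lemma le_minorized_integral f g : minorized f -> minorized g ->
  {ae mu, forall w, f w <= g w} -> \int[mu]_w f w <= \int[mu]_w g w.
Proof.
move=> mf mg fg; have [gy|] := ltP (\int[mu]_w g w) +oo; last first.
  by rewrite leye_eq => /eqP ->; exact: leey.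
have ig := minorized_integrable mg gy.
rewrite (integralE _ _ f) (integralE _ _ g) leeB//.
  apply: ae_ge0_le_integral => //.
  - exact: measurable_funepos mf.1.
  - exact: measurable_funepos mg.1.
  - apply: filterS fg => w fgw _.
    by rewrite !funeposE ge_max !le_max fgw lexx orbT.
apply: ae_ge0_le_integral => //.
- exact: measurable_funeneg mg.1.
- exact: measurable_funeneg mf.1.
- apply: filterS fg => w fgw _.
  by rewrite !funenegE ge_max !le_max leeN2 fgw lexx orbT.
Qed.

Lemma minorized_integralD f g : minorized f -> minorized g ->
  \int[mu]_w (f w + g w) = \int[mu]_w f w + \int[mu]_w g w.
Proof.
(* If the sum had an integral below [+oo], subtracting the integrable minorant [m] of [f'] would
   leave an integrable function above [g'], against the infinite integral of [g']. *)
have inf_r f' g' : minorized f' -> minorized g' ->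
    \int[mu]_w g' w = +oo -> \int[mu]_w (f' w + g' w) = +oo.
  move=> mf mg g_y; apply/eqP; rewrite -leye_eq leNgt; apply/negP => fgy.
  have mfg := minorizedD mf mg.
  have ifg := minorized_integrable mfg fgy.
  have [_ [m [im mf_le]]] := mf.
  have ih := integrableB measurableT ifg im.
  have leB (x y : \bar R) (r : R) : r%:E + x <= y -> x <= y - r%:E.
    by rewrite leeBrDl.
  have : \int[mu]_w g' w <= \int[mu]_w ((f' \+ g') w - (EFin \o m) w).
    apply: le_minorized_integral => //.
      split; first by case/integrableP: ih.
      have [_ [n [i_n ng_le]]] := mg.
      exists n; split=> //; apply: filterS2 mf_le ng_le => w mw nw /=.
      by apply: leB; exact: leeD.
    apply: filterS2 mf_le (minorized_gtNy mg) => w mw _ /=.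
    by apply: leB; exact: leeD2r.
  rewrite g_y leye_eq => /eqP hy.
  by have := integrable_fin_num measurableT ih; rewrite hy.
move=> mf mg.
have [gy|] := ltP (\int[mu]_w g w) +oo; last first.
  rewrite leye_eq => /eqP g_y; rewrite inf_r// g_y addey//.
  by rewrite gt_eqF// minorized_integral_gtNy.
have [fy|] := ltP (\int[mu]_w f w) +oo; last first.
  rewrite leye_eq => /eqP f_y; under eq_integral do rewrite addeC.
  rewrite inf_r// f_y addye//.
  by rewrite gt_eqF// minorized_integral_gtNy.
by rewrite integralD//; exact: minorized_integrable.
Qed.

(** The difference [g - f] is nonnegative with zero integral. This turns equal costs into pointwise
    equalities, and integrability adds the finiteness that [argmin] demands. *)
Lemma minorized_integral_eq f g : minorized f -> minorized g ->
  {ae mu, forall w, f w <= g w} ->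
  \int[mu]_w g w <= \int[mu]_w f w -> \int[mu]_w f w < +oo ->
  {ae mu, forall w, f w = g w /\ f w < +oo}.
Proof.
move=> mf mg fg gf fy.
have i_f := minorized_integrable mf fy.
have ig := minorized_integrable mg (le_lt_trans gf fy).
have eq_fg : \int[mu]_w f w = \int[mu]_w g w.
  by apply/eqP; rewrite eq_le gf le_minorized_integral.
have := integralB measurableT ig i_f; rewrite eq_fg subee; last first.
  exact: integrable_fin_num.
have iB := integrableB measurableT ig i_f.
have mB : measurable_fun setT (g \- f) by case/integrableP: iB.
have ff := integrable_ae measurableT i_f.
have gf' := integrable_ae measurableT ig.
have absE : \int[mu]_w `|(g \- f) w| = \int[mu]_w (g \- f) w.
  apply: ae_eq_integral => //; first exact: measurableT_comp.
  apply: filterS3 fg ff gf' => w fgw /(_ I) fw /(_ I) gw _ /=.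
  by rewrite gee0_abs// sube_ge0 ?fw.
rewrite -absE => /(ae_eq_integral_abs mu measurableT mB).
apply: filterS3 ff gf' => w /(_ I) + /(_ I) + /(_ I) /=.
case: (f w) (g w) => [r| |] [q| |] // _ _ /eqP.
by rewrite -EFinB eqe subr_eq0 => /eqP ->; split; rewrite ?ltry.
Qed.

End minorized_functions.

(** * Minorized functions on a probability space *)

Section minorized_random_variables.
Context {d : measure_display} {T : measurableType d} {R : realType}.
Variable P : probability T R.
Implicit Types f g : T -> \bar R.

Lemma minorized_cst (r : R) : minorized P (cst r%:E).
Proof.
split; first exact: measurable_cst.
exists (cst r); split; last by apply: aeW => w; exact: lexx.
exact: finite_measure_integrable_cst.
Qed.

Lemma probability_integral_cst (x : \bar R) : \int[P]_w cst x w = x.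
Proof.
transitivity (x * P setT); first exact: integral_cst.
by rewrite probability_setT mule1.
Qed.

(** Selections are near-optimal only where the optimal value is finite; integrability of [g] makes
    the remaining points negligible. *)
Lemma minorized_integral_le_add f g (e : R) : minorized P f -> minorized P g ->
  \int[P]_w g w < +oo ->
  {ae P, forall w, g w \is a fin_num -> f w <= g w + e%:E} ->
  \int[P]_w f w <= \int[P]_w g w + e%:E.
Proof.
move=> mf mg gfin fg; have me := minorized_cst e.
rewrite -[in leRHS](probability_integral_cst e%:E) -minorized_integralD//.
apply: le_minorized_integral => //; first exact: minorizedD.
have := integrable_ae measurableT (minorized_integrable mg gfin).
by apply: filterS2 fg => w fg /(_ I) /fg.
Qed.

End minorized_random_variables.

(** * Almost sure events *)

Section almost_sure_events.
Context {d : measure_display} {T : measurableType d} {R : realType}.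
Variable P : probability T R.

Lemma ae_probability1 (E : set T) : measurable E -> P E = 1 ->
  {ae P, forall w, E w}.
Proof.
move=> mE PE; apply/negligibleP; first exact: measurableC.
transitivity (1 - P E); first exact: probability_setC.
by rewrite PE subee.
Qed.

Lemma ae_inhabited (E : set T) : {ae P, forall w, E w} -> E !=set0.
Proof.
move=> aeE; have P1 : 0 < P setT.
  by apply: lt_le_trans lte01 _; rewrite probability_setT.
by have /filter_ex := aeE; apply; exact: ae_properfilter_algebraOfSetsType.
Qed.

End almost_sure_events.

(** * Dynamic programming: the Bellman equations in usable form *)

Section dynamic_programming.
Context {d : measure_display} {Omega : measurableType d} {R : realType}.
Variables (P : probability Omega R) (T N Mb Ma : nat).
Local Notation state := 'cV[R]_N.
Local Notation ctrlb := 'cV[R]_Mb.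
Local Notation ctrla := 'cV[R]_Ma.
Variables (F : nat -> set (set Omega))
  (L : nat -> (state * ctrlb * ctrla)%type -> Omega -> \bar R)
  (JT : state -> Omega -> \bar R)
  (A : nat -> Omega -> 'M[R]_N) (Bb : nat -> Omega -> 'M[R]_(N, Mb))
  (Ba : nat -> Omega -> 'M[R]_(N, Ma)) (W : nat -> Omega -> state)
  (J : nat -> state -> Omega -> \bar R)
  (Q EQ : nat -> (state * ctrlb)%type -> Omega -> \bar R).
Let Fd := affine_dynamics A Bb Ba W.
Hypotheses (F_filtration : filtration F T)
  (F0_trivial : forall E, F 0%N E -> P E = 0 \/ P E = 1)
  (L_normal : forall t, (t < T)%N -> normal_integrand (F t.+1) (L t))
  (L_minor : forall t, (t < T)%N -> lower_bounded P (L t))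
  (JT_normal : normal_integrand (F T) JT)
  (dynamics_measurable : forall t, (t < T)%N ->
    [/\ rv_wrt (F t.+1) (A t.+1), rv_wrt (F t.+1) (Bb t.+1),
        rv_wrt (F t.+1) (Ba t.+1) & rv_wrt (F t.+1) (W t.+1)])
  (JQ_solution : normal_bellman_solution P F L Fd T JT J Q EQ)
  (J_minor : forall t, (t <= T)%N -> lower_bounded P (J t))
  (Q_minor : forall t, (t < T)%N -> lower_bounded P (Q t)).

Let sigF t : (t <= T)%N -> sigma_algebra setT (F t).
Proof. by move=> tT; have [/(_ t tT)[]] := F_filtration. Qed.

Let F_measurable t : (t <= T)%N -> F t `<=` measurable.
Proof. by move=> tT; have [/(_ t tT)[]] := F_filtration. Qed.

Let F_next t : (t < T)%N -> F t `<=` F t.+1.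
Proof. by move=> tT; have [_ /(_ t tT)] := F_filtration. Qed.

Let J_normal t : (t <= T)%N -> normal_integrand measurable (J t).
Proof. by have [+ _ _ _] := JQ_solution; apply. Qed.

Let Q_normal t : (t < T)%N -> normal_integrand measurable (Q t).
Proof. by have [_ + _ _] := JQ_solution; apply. Qed.

Let EQ_condexp t : (t < T)%N -> is_condexp_integrand P (F t) (Q t) (EQ t).
Proof. by have [_ _ + _] := JQ_solution; apply. Qed.

Let sep_xb : separable_space (state * ctrlb)%type.
Proof. by apply: separable_prod; exact: separable_matrix. Qed.

Let sep_xba : separable_space (state * ctrlb * ctrla)%type.
Proof. by apply: separable_prod => //; exact: separable_matrix. Qed.

(* [J t] is only assumed measurable for the full sigma-algebra; [pre_value t]
   is [F t]-measurable and has [J t] as its partial infimum over the second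
   argument. *)
Let pre_value t : (state * ctrlb)%type -> Omega -> \bar R :=
  if (t < T)%N then EQ t else fun p => JT p.1.

Let pre_value_closed t w : (t <= T)%N -> closed (epi (pre_value t ^~ w)).
Proof.
rewrite /pre_value; case: ltnP => [tT _|_ _].
  by have [[+ _] _] := EQ_condexp tT; apply.
have [+ _] := JT_normal => /(_ w).
apply: (@closed_comp _ _ (fun p : (state * ctrlb) * R^o => (p.1.1, p.2))).
move=> p _; apply: pair_continuous; last exact: snd_continuous.
exact: comp_continuous (@fst_continuous _ _) (@fst_continuous _ _).
Qed.

Let pre_value_random t : (t <= T)%N ->
  random_set (T := g_sigma_algebraType (F t))
    (fun w => epi (pre_value t ^~ w)).
Proof.
rewrite /pre_value; case: ltnP => [tT _|Tt tT].
  apply: normal_integrand_g_sigma; first exact: sigF (ltnW tT).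
  by have [] := EQ_condexp tT.
have -> : t = T by apply/eqP; rewrite eqn_leq tT.
move=> [[x u] a] r.
have := normal_integrand_g_sigma (sigF (leqnn T)) JT_normal (x, a) r.
congr measurable; apply/seteqP; split=> w /= [].
  move=> [y b] [JTy [/= xy ab]]; exists ((y, u), b); split=> //.
  split=> //; split=> //=; apply: ballxx.
  (* The dummy control is taken at the centre [u]; the radius is positive because the ball around
     [x] contains a point. *)
  by move: xy; rewrite -ball_normE /=; exact: le_lt_trans.
by move=> [[y v] b] [JTy [[/= xy _] ab]]; exists (y, b).
Qed.

Let J_gtNy : {ae P, forall w, forall t, (t <= T)%N -> forall x, -oo < J t x w}.
Proof.
apply: ae_foralln => t; have [tT|tT] := boolP (t <= T)%N; last exact: aeW.
have [m [_]] := J_minor tT; apply: filterS => w mw _ x.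
exact: lt_le_trans (ltNyr _) (mw x).
Qed.

Let L_gtNy : {ae P, forall w, forall t, (t < T)%N -> forall p, -oo < L t p w}.
Proof.
apply: ae_foralln => t; have [tT|tT] := boolP (t < T)%N; last exact: aeW.
have [m [_]] := L_minor tT; apply: filterS => w mw _ x.
exact: lt_le_trans (ltNyr _) (mw x).
Qed.

(** Covers the Bellman infimum and the terminal condition at once: at [T] the infimum runs over a
    constant function of the control. *)
Let J_eq : {ae P, forall w, forall t, (t <= T)%N -> forall x,
  J t x w = ereal_inf (range (fun ub => pre_value t (x, ub) w))}.
Proof.
have [_ _ _] := JQ_solution; apply: filterS => w [JTw bell] t tT x.
rewrite /pre_value; case: ltnP => [tT'|Tt].
  by have [] := bell t tT' x 0%R.
have -> : t = T by apply/eqP; rewrite eqn_leq tT.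
rewrite JTw; have -> : range (fun _ : ctrlb => JT x w) = [set JT x w].
  by apply/seteqP; split=> [_ [_ _ <-]|_ ->] //; exists 0%R.
by rewrite ereal_inf1.
Qed.

Let Q_eq : {ae P, forall w, forall t, (t < T)%N -> forall x ub,
  Q t (x, ub) w = ereal_inf (range (fun ua =>
    L t (x, ub, ua) w + J t.+1 (Fd t x ub ua w) w))}.
Proof.
have [_ _ _] := JQ_solution; apply: filterS => w [_ bell] t tT x ub.
by have [] := bell t tT x ub.
Qed.

Let minorized_integrand (V : normedModType R) G (h : V -> Omega -> \bar R)
    (x : Omega -> V) : separable_space V -> normal_integrand measurable h ->
  lower_bounded P h -> G `<=` measurable -> rv_wrt G x ->
  minorized P (fun w => h (x w) w).
Proof.
move=> sV nh [m [im mle]] Gm rx; split.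
  by apply: measurable_normal_integrand => //; exact: rv_wrt_borel rx.
by exists m; split=> //; apply: filterS mle => w; exact.
Qed.

(** * Costs along a fixed adapted process *)

Section process.
Variables (s : nat) (X : nat -> Omega -> state) (Ub : nat -> Omega -> ctrlb)
  (Ua : nat -> Omega -> ctrla).
Hypotheses (sT : (s <= T)%N) (ad : adapted F s X Ub Ua).

Lemma rv_XUb t : (t <= s)%N -> rv_wrt (F t) (fun w => (X t w, Ub t w)).
Proof.
move=> ts; have [rX rb _] := ad ts; apply: rv_wrt_pair => //.
- exact: sigF (leq_trans ts sT).
- exact: separable_matrix.
- exact: separable_matrix.
Qed.

Lemma rv_XUbUa t : (t < s)%N ->
  rv_wrt (F t.+1) (fun w => (X t w, Ub t w, Ua t.+1 w)).
Proof.
move=> ts; have [_ _ ra] := ad ts; apply: rv_wrt_pair => //.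
- exact: sigF (leq_trans ts sT).
- exact: separable_matrix.
- apply: rv_wrt_sub (rv_XUb (ltnW ts)); apply: F_next.
  exact: leq_trans ts sT.
Qed.

Lemma minorized_L t : (t < s)%N ->
  minorized P (fun w => L t (X t w, Ub t w, Ua t.+1 w) w).
Proof.
move=> ts; have tT := leq_trans ts sT.
apply: (minorized_integrand _ _ _ (F_measurable tT) (rv_XUbUa ts)) => //.
- exact: normal_integrand_sub (F_measurable tT) (L_normal tT).
- exact: L_minor.
Qed.

Lemma minorized_J t : (t <= s)%N -> minorized P (fun w => J t (X t w) w).
Proof.
move=> ts; have tT := leq_trans ts sT; have [rX _ _] := ad ts.
apply: (minorized_integrand _ _ _ (F_measurable tT) rX) => //.
- exact: separable_matrix.
- exact: J_normal.
- exact: J_minor.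
Qed.

Lemma minorized_Q t : (t <= s)%N -> (t < T)%N ->
  minorized P (fun w => Q t (X t w, Ub t w) w).
Proof.
move=> ts tT; apply: (minorized_integrand _ _ _ (F_measurable (ltnW tT))
  (rv_XUb ts)) => //; first exact: Q_normal.
exact: Q_minor.
Qed.

Lemma J_le_EQ t : (t < T)%N ->
  {ae P, forall w, J t (X t w) w <= EQ t (X t w, Ub t w) w}.
Proof.
move=> tT; apply: filterS J_eq => w /(_ t (ltnW tT) (X t w)) ->.
by rewrite /pre_value tT; apply: ereal_inf_lbound; exists (Ub t w).
Qed.

(** No lower bound comes with [EQ t] itself; the minorant of [J t] along the process is inherited
    through [J_le_EQ]. *)
Lemma minorized_EQ t : (t <= s)%N -> (t < T)%N ->
  minorized P (fun w => EQ t (X t w, Ub t w) w).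
Proof.
move=> ts tT; split.
  apply: measurable_normal_integrand => //; last first.
    exact: rv_wrt_borel (F_measurable (ltnW tT)) (rv_XUb ts).
  apply: normal_integrand_sub (F_measurable (ltnW tT)) _.
  by have [] := EQ_condexp tT.
have [_ [m [im mle]]] := minorized_J ts.
by exists m; split=> //; apply: filterS2 mle (J_le_EQ tT) => w; exact: le_trans.
Qed.

Lemma integral_EQ t : (t <= s)%N -> (t < T)%N ->
  \int[P]_w EQ t (X t w, Ub t w) w = \int[P]_w Q t (X t w, Ub t w) w.
Proof.
move=> ts tT; have [_ /(_ _ (rv_XUb ts))[_ /(_ setT)]] := EQ_condexp tT.
apply; have [F0 FC _] := sigF (ltnW tT).
by have := FC _ F0; rewrite setD0.
Qed.

Lemma minorized_run r : (r <= s)%N ->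
  minorized P (fun w => \sum_(t < r) L t (X t w, Ub t w, Ua t.+1 w) w).
Proof.
move=> rs; apply: minorized_sum => t; apply: minorized_L.
exact: leq_trans (ltn_ord t) rs.
Qed.

Lemma cost_split r : (r <= s)%N -> cost P L r (J r) X Ub Ua =
  \int[P]_w (\sum_(t < r) L t (X t w, Ub t w, Ua t.+1 w) w) +
  \int[P]_w J r (X r w) w.
Proof.
move=> rs; rewrite /cost minorized_integralD//; first exact: minorized_run.
exact: minorized_J.
Qed.

(** The last running cost is grouped with the terminal one, so that comparison with [cost_split] at
    [r] involves a single period. *)
Lemma cost_split_last r : (r < s)%N -> cost P L r.+1 (J r.+1) X Ub Ua =
  \int[P]_w (\sum_(t < r) L t (X t w, Ub t w, Ua t.+1 w) w) +
  \int[P]_w (L r (X r w, Ub r w, Ua r.+1 w) w + J r.+1 (X r.+1 w) w).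
Proof.
move=> rs; rewrite -minorized_integralD.
- by apply: eq_integral => w _; rewrite big_ord_recr /= addeA.
- exact: minorized_run (ltnW rs).
- by apply: minorizedD; [exact: minorized_L|exact: minorized_J].
Qed.

Hypothesis dyn : {ae P, forall w, forall t, (t < s)%N ->
  X t.+1 w = Fd t (X t w) (Ub t w) (Ua t.+1 w) w}.

Lemma Q_le_step t : (t < s)%N -> {ae P, forall w, Q t (X t w, Ub t w) w <=
  L t (X t w, Ub t w, Ua t.+1 w) w + J t.+1 (X t.+1 w) w}.
Proof.
move=> ts; apply: filterS2 Q_eq dyn => w.
move=> /(_ t (leq_trans ts sT)) -> /(_ t ts) ->.
by apply: ereal_inf_lbound; exists (Ua t.+1 w).
Qed.

Lemma integral_EQ_le_step t : (t < s)%N ->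
  \int[P]_w EQ t (X t w, Ub t w) w <=
  \int[P]_w (L t (X t w, Ub t w, Ua t.+1 w) w + J t.+1 (X t.+1 w) w).
Proof.
move=> ts; have tT := leq_trans ts sT; rewrite integral_EQ// 1?ltnW//.
apply: le_minorized_integral; last exact: Q_le_step.
  exact: minorized_Q (ltnW ts) tT.
by apply: minorizedD; [exact: minorized_L|exact: minorized_J].
Qed.

Lemma integral_J_le_EQ t : (t < s)%N ->
  \int[P]_w J t (X t w) w <= \int[P]_w EQ t (X t w, Ub t w) w.
Proof.
move=> ts; have tT := leq_trans ts sT.
apply: le_minorized_integral; last exact: J_le_EQ.
  exact: minorized_J (ltnW ts).
exact: minorized_EQ (ltnW ts) tT.
Qed.

Lemma cost_le_next t : (t < s)%N ->
  cost P L t (J t) X Ub Ua <= cost P L t.+1 (J t.+1) X Ub Ua.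
Proof.
move=> ts; rewrite cost_split 1?ltnW// cost_split_last//.
apply: leeD2l; apply: le_trans (integral_J_le_EQ ts) _.
exact: integral_EQ_le_step.
Qed.

End process.

(** * Measurable near-optimal controls *)

Lemma select_ub s (x : Omega -> state) (e : R) : (s < T)%N ->
  rv_wrt (F s) x -> (0 < e)%R -> exists ub : Omega -> ctrlb, rv_wrt (F s) ub /\
    {ae P, forall w, J s (x w) w \is a fin_num ->
       EQ s (x w, ub w) w <= J s (x w) w + e%:E}.
Proof.
move=> sT rx e0; have sF := sigF (ltnW sT).
(* This point lies in the epigraph of [pre_value s], which is [EQ s], exactly when [u] has value at
   most [a] at the state [x w]. *)
pose Phi (a : R) (u : ctrlb) w := ((x w, u), a : R^o).
have bPhi a u : borel_fun (T := g_sigma_algebraType (F s)) (Phi a u).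
  apply/(rv_wrtP _ sF); apply: rv_wrt_pair => //; last exact: rv_wrt_cst.
    exact: separable_real.
  apply: rv_wrt_pair => //; try exact: separable_matrix.
  exact: rv_wrt_cst.
have cPhi a w : continuous (Phi a ^~ w).
  apply: pair_continuous; last exact: cst_continuous.
  by apply: pair_continuous; [exact: cst_continuous|move=> z; exact: cvg_id].
have cD w : closed (epi (pre_value s ^~ w)) := @pre_value_closed s w (ltnW sT).
have [|ub [/(rv_wrtP _ sF) rub ubP]] := near_optimal_selection
  (separable_matrix _ _) (@boundedly_compact_colvec R Mb)
  (separable_prod sep_xb separable_real) (pre_value_random (ltnW sT)) cD
  bPhi cPhi _ e0.
  by move=> a a' u w aa'; rewrite /epi /= => /le_trans; apply; rewrite lee_fin.
exists ub; split=> //.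
apply: filterS J_eq => w /(_ s (ltnW sT) (x w)) Jw Jfin.
have := ubP w (fun u => EQ s (x w, u) w) (fine (J s (x w) w)).
rewrite EFinD fineK//; apply.
- by move=> a u; rewrite /epi /= /pre_value sT.
- by move=> u; rewrite Jw /pre_value sT; apply: ereal_inf_lbound; exists u.
- move=> a; rewrite -lte_fin fineK// Jw => /ereal_inf_lt[_ [u _ <-] ua].
  by exists u; rewrite /epi /=; exact: ltW.
Qed.

Lemma rv_Fd s (x : Omega -> state) (ub : Omega -> ctrlb) (ua : Omega -> ctrla) :
  (s < T)%N -> rv_wrt (F s.+1) x -> rv_wrt (F s.+1) ub ->
  rv_wrt (F s.+1) ua -> rv_wrt (F s.+1) (fun w => Fd s (x w) (ub w) (ua w) w).
Proof.
move=> sT rx rb ra; have [rA rBb rBa rW] := dynamics_measurable sT.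
have sF := sigF sT.
by do 3?[apply: rv_wrt_add => //]; exact: rv_wrt_mulmx.
Qed.

(** A sum is at most [a] as soon as one term is at most [l] and the other at most [a - l]. With [l]
    and the next control [ub'] as extra selection variables, the constraint becomes a product of two
    [F s.+1]-measurable epigraphs; both extras are discarded afterwards. *)
Lemma select_ua s (x : Omega -> state) (ub : Omega -> ctrlb) (e : R) :
  (s < T)%N -> rv_wrt (F s.+1) x -> rv_wrt (F s.+1) ub ->
  (0 < e)%R -> exists ua : Omega -> ctrla, rv_wrt (F s.+1) ua /\
    {ae P, forall w, Q s (x w, ub w) w \is a fin_num ->
       L s (x w, ub w, ua w) w + J s.+1 (Fd s (x w) (ub w) (ua w) w) w
       <= Q s (x w, ub w) w + e%:E}.
Proof.
move=> sT rx rb e0; have sF := sigF sT.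
pose D w := epi (L s ^~ w) `*` epi (pre_value s.+1 ^~ w).
pose Phi (a : R) (z : ctrla * ctrlb * R^o) w :=
  (((x w, ub w, z.1.1), z.2),
   ((Fd s (x w) (ub w) z.1.1 w, z.1.2), (a - z.2 : R^o)%R)).
have sepV : separable_space (((state * ctrlb * ctrla) * R^o) *
    ((state * ctrlb) * R^o))%type.
  by do ?[apply: separable_prod => //]; exact: separable_real.
have bPhi a z : borel_fun (T := g_sigma_algebraType (F s.+1)) (Phi a z).
  apply/(rv_wrtP _ sF); apply: rv_wrt_pair => //;
    do ?[apply: separable_prod => //]; do ?[exact: separable_real].
    apply: rv_wrt_pair => //; do ?[exact: separable_real];
      do ?[exact: rv_wrt_cst].
    apply: rv_wrt_pair => //; do ?[exact: separable_matrix];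
      do ?[exact: rv_wrt_cst].
    by apply: rv_wrt_pair => //; exact: separable_matrix.
  apply: rv_wrt_pair => //; do ?[exact: separable_real];
      do ?[exact: rv_wrt_cst].
  apply: rv_wrt_pair => //; do ?[exact: separable_matrix];
      do ?[exact: rv_wrt_cst].
  by apply: rv_Fd => //; exact: rv_wrt_cst.
have cua : continuous (fun z : ctrla * ctrlb * R^o => z.1.1).
  exact: comp_continuous (@fst_continuous _ _) (@fst_continuous _ _).
have cPhi a w : continuous (Phi a ^~ w).
  apply: pair_continuous.
    apply: pair_continuous; last exact: snd_continuous.
    by apply: pair_continuous => //; exact: cst_continuous.
  apply: pair_continuous.
    apply: pair_continuous.
      exact: (comp_continuous cua (@affine_dynamics_continuous _ _ _ _ _ _
        A Bb Ba W s (x w) (ub w) w)).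
    exact: comp_continuous (@fst_continuous _ _) (@snd_continuous _ _).
  move=> z; apply: cvgB; [exact: cvg_cst|exact: cvg_snd].
have cD w : closed (D w).
  rewrite (_ : D w = fst @^-1` epi (L s ^~ w) `&`
    snd @^-1` epi (pre_value s.+1 ^~ w)) //.
  apply: closedI; apply: closed_comp => [z _|].
  - exact: fst_continuous.
  - by have [+ _] := L_normal sT; apply.
  - exact: snd_continuous.
  - exact: pre_value_closed.
have rD : random_set (T := g_sigma_algebraType (F s.+1)) D.
  apply: random_set_prod; last exact: pre_value_random.
  exact: normal_integrand_g_sigma (L_normal sT).
have cptZ : boundedly_compact (ctrla * ctrlb * R^o)%type.
  apply: boundedly_compact_prod; last exact: boundedly_compact_real.
  by apply: boundedly_compact_prod; exact: boundedly_compact_colvec.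
have sepZ : separable_space (ctrla * ctrlb * R^o)%type.
  apply: separable_prod; last exact: separable_real.
  by apply: separable_prod; exact: separable_matrix.
have [|z [/(rv_wrtP _ sF) rz zP]] := near_optimal_selection
  sepZ cptZ sepV rD cD bPhi cPhi _ e0.
  move=> a a' z w aa' []; rewrite /D /Phi /epi /= => ? /le_trans le_a.
  split=> //=.
  by apply: le_a; rewrite lee_fin lerD2r.
exists (fun w => (z w).1.1); split.
  exact: (rv_wrt_comp sF cua rz).
apply: filterS3 J_eq Q_eq (filterI J_gtNy L_gtNy) => w /(_ s.+1 sT) Jw.
move=> /(_ s sT (x w) (ub w)) Qw [/(_ s.+1 sT) JNy /(_ s sT) LNy] Qfin.
have := zP w (fun z => L s (x w, ub w, z.1.1) w +
  J s.+1 (Fd s (x w) (ub w) z.1.1 w) w) (fine (Q s (x w, ub w) w)).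
rewrite EFinD fineK//; apply.
- move=> a z' [/= Lz Jz]; rewrite -(subrK z'.2 a) addrC EFinD.
  apply: leeD => //.
  apply: le_trans Jz; rewrite Jw.
  by apply: ereal_inf_lbound; exists z'.1.2.
- by move=> z'; rewrite Qw; apply: ereal_inf_lbound; exists z'.1.1.
- move=> a; rewrite -lte_fin fineK// Qw => /ereal_inf_lt[_ [ua _ <-]].
  (* The running cost is real: [+oo] would make the sum infinite, as [J s.+1] is never [-oo]. Its
     value [l] is the witness for the splitting. *)
  move: (LNy (x w, ub w, ua)); case El: (L s _ w) => [l| |] // _; last first.
    by rewrite addye ?gt_eqF// ltNge leey.
  rewrite -lteBrDl// Jw => /ereal_inf_lt[_ [u _ <-] Ju].
  exists (ua, u, l : R^o); split; rewrite /epi /= ?El//.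
  exact: ltW.
Qed.

(** * Extension by one period, and equality of successive optimum values *)

Lemma feasible_sub r s X Ub Ua : (r <= s)%N ->
  feasible P F Fd s X Ub Ua -> feasible P F Fd r X Ub Ua.
Proof.
move=> rs [ad dyn]; split; first by move=> t tr; exact: ad (leq_trans tr rs).
by apply: filterS dyn => w dw t tr; exact: dw (leq_trans tr rs).
Qed.

Lemma near_optimal_extension s X Ub Ua (e : R) : (s < T)%N ->
  feasible P F Fd s X Ub Ua -> cost P L s (J s) X Ub Ua < +oo -> (0 < e)%R ->
  exists X' Ub' Ua', feasible P F Fd s.+1 X' Ub' Ua' /\
    cost P L s.+1 (J s.+1) X' Ub' Ua' <= cost P L s (J s) X Ub Ua + e%:E.
Proof.
move=> sT [ad dyn] cfin e0; have sT' := ltnW sT.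
(* One half of the error is spent on [ub], the other on [ua]. *)
have e20 : (0 < e / 2)%R by lra.
have [rX _ _] := ad s (leqnn s).
have [ub [rub ubP]] := select_ub sT rX e20.
have [ua [rua uaP]] := select_ua sT (rv_wrt_sub (F_next sT) rX)
  (rv_wrt_sub (F_next sT) rub) e20.
pose X' t := if t == s.+1 then (fun w => Fd s (X s w) (ub w) (ua w) w) else X t.
(* Adaptedness up to [s.+1] also concerns the control at time [s.+1], where [Ub] is not known to be
   measurable; zero is, and this value does not enter the cost. *)
pose Ub' t := if t == s then ub else if (t < s)%N then Ub t else cst 0%R.
pose Ua' t := if t == s.+1 then ua else Ua t.
have X'E t : (t <= s)%N -> X' t = X t by move=> ts; rewrite /X' ltn_eqF.
have X'S : X' s.+1 = (fun w => Fd s (X s w) (ub w) (ua w) w).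
  by rewrite /X' eqxx.
have Ub's : Ub' s = ub by rewrite /Ub' eqxx.
have Ub'E t : (t < s)%N -> Ub' t = Ub t by move=> ts; rewrite /Ub' ltn_eqF// ts.
have Ua'E t : (t <= s)%N -> Ua' t = Ua t by move=> ts; rewrite /Ua' ltn_eqF.
have Ua'S : Ua' s.+1 = ua by rewrite /Ua' eqxx.
have ad' : adapted F s.+1 X' Ub' Ua'.
  move=> t; rewrite leq_eqVlt ltnS => /predU1P[->|ts].
    rewrite X'S Ua'S; split=> //.
      by apply: rv_Fd => //; apply: rv_wrt_sub (F_next sT) _.
    by rewrite /Ub' gtn_eqF// ltnNge leqnSn; exact: rv_wrt_cst (sigF sT).
  have [rXt rUb rUa] := ad t ts; rewrite X'E// Ua'E//; split=> //.
  move: ts; rewrite leq_eqVlt => /predU1P[->|ts]; first by rewrite Ub's.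
  by rewrite Ub'E.
have dyn' : {ae P, forall w, forall t, (t < s.+1)%N ->
    X' t.+1 w = Fd t (X' t w) (Ub' t w) (Ua' t.+1 w) w}.
  apply: filterS dyn => w dw t; rewrite ltnS leq_eqVlt => /predU1P[->|ts].
    by rewrite X'S X'E// Ub's Ua'S.
  by rewrite (X'E _ ts) (X'E _ (ltnW ts)) (Ub'E _ ts) (Ua'E _ ts) dw.
exists X', Ub', Ua'; split=> //.
have mrun := minorized_run sT' ad (leqnn s).
have mJ := minorized_J sT' ad (leqnn s).
have mEQ := minorized_EQ sT ad' (leqnSn s) sT.
have mQ := minorized_Q sT ad' (leqnSn s) sT.
have mLJ := minorizedD (minorized_L sT ad' (ltnSn s))
  (minorized_J sT ad' (leqnn s.+1)).
have iEQ := integral_EQ sT ad' (leqnSn s) sT.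
rewrite (cost_split_last sT ad' (ltnSn s)).
move: cfin; rewrite (cost_split sT' ad (leqnn s)).
move: mEQ mQ mLJ iEQ; rewrite X'E// Ub's Ua'S X'S => mEQ mQ mLJ iEQ cfin.
have -> : \int[P]_w (\sum_(t < s) L t (X' t w, Ub' t w, Ua' t.+1 w) w) =
    \int[P]_w (\sum_(t < s) L t (X t w, Ub t w, Ua t.+1 w) w).
  apply: eq_integral => w _; apply: eq_bigr => t _.
  have ts := ltn_ord t.
  by rewrite (X'E _ (ltnW ts)) (Ub'E _ ts) (Ua'E _ ts).
rewrite -[leRHS]addeA; apply: leeD2l.
(* The running cost integrates to more than [-oo], so an infinite integral of [J s] would make the
   whole cost infinite. *)
have Jfin : \int[P]_w J s (X s w) w < +oo.
  rewrite ltNge leye_eq; apply/negP => /eqP Jy; move: cfin.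
  by rewrite Jy addey// gt_eqF// minorized_integral_gtNy.
have EQ_le : \int[P]_w EQ s (X s w, ub w) w <=
    \int[P]_w J s (X s w) w + (e / 2)%:E.
  exact: minorized_integral_le_add.
have Qfin : \int[P]_w Q s (X s w, ub w) w < +oo.
  rewrite -iEQ; apply: le_lt_trans EQ_le _.
  by rewrite lte_add_pinfty// ltry.
apply: le_trans (minorized_integral_le_add mLJ mQ Qfin uaP) _.
rewrite -iEQ [in leRHS](splitr e) EFinD addeA; exact: leeD2r.
Qed.

Lemma optimum_value_next s : (s < T)%N ->
  optimum_value P F L Fd s.+1 (J s.+1) = optimum_value P F L Fd s (J s).
Proof.
move=> sT; apply/eqP; rewrite eq_le; apply/andP; split; last first.
  apply/ereal_infP => _ [X [Ub [Ua [fea ->]]]].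
  apply: le_trans (cost_le_next sT fea.1 fea.2 (ltnSn s)).
  apply: ereal_inf_lbound; exists X, Ub, Ua; split=> //.
  exact: feasible_sub (leqnSn s) fea.
apply/ereal_infP => _ [X [Ub [Ua [fea ->]]]].
have [cfin|] := ltP (cost P L s (J s) X Ub Ua) +oo; last first.
  by rewrite leye_eq => /eqP ->; exact: leey.
apply/lee_addgt0Pr => e e0.
have [X' [Ub' [Ua' [fea' le']]]] := near_optimal_extension sT fea cfin e0.
by apply: le_trans le'; apply: ereal_inf_lbound; exists X', Ub', Ua'.
Qed.

Lemma optimum_value_0 s : (s <= T)%N ->
  optimum_value P F L Fd s (J s) = optimum_value P F L Fd 0 (J 0%N).
Proof.
by elim: s => // s IH sT; rewrite optimum_value_next// IH// ltnW.
Qed.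

(** * The initial time: zero-one law and optimum value at horizon [0] *)

Lemma inf_J0_cst :
  exists c, {ae P, forall w, ereal_inf (range (J 0%N ^~ w)) = c}.
Proof.
have sF := sigF (leq0n T).
(* Phrased with [pre_value 0] rather than [J 0], this event belongs to [F 0] and so has probability
   zero or one. *)
pose E (r : R) := [set w | exists z, pre_value 0 z w <= r%:E].
have FE r : F 0%N (E r).
  rewrite -(measurable_g_measurableTypeE sF).
  apply: (@measurable_hit _ (g_sigma_algebraType (F 0%N)) R _ _ sep_xb _
    (separable_prod sep_xb separable_real) (fun w => epi (pre_value 0 ^~ w))
    (fun z _ => (z, r : R^o))).
  - by apply: boundedly_compact_prod; exact: boundedly_compact_colvec.
  - exact: pre_value_random.
  - by move=> w; exact: pre_value_closed.
  - by move=> z; exact: borel_cst.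
  - move=> w; apply: pair_continuous; last exact: cst_continuous.
    by move=> z; exact: cvg_id.
pose S := [set q : rat | P (E (ratr q)) = 1].
exists (ereal_inf [set (ratr q)%:E | q in S]).
have aeE (q : rat) : {ae P, forall w, E (ratr q) w <-> S q}.
  have mE : measurable (E (ratr q)) := F_measurable (leq0n T) (FE _).
  have [P0|P1] := F0_trivial (FE (ratr q)); last first.
    by apply: filterS (ae_probability1 mE P1) => w.
  have PC : P (~` E (ratr q)) = 1.
    have -> : P (~` E (ratr q)) = 1 - P (E (ratr q)) by exact: probability_setC.
    by rewrite P0 sube0.
  apply: filterS (ae_probability1 (measurableC mE) PC) => w nE; split=> //.
  by rewrite /S /= P0 => /esym/eqP; rewrite onee_eq0.
have {}aeE : {ae P, forall w, forall q : rat, E (ratr q) w <-> S q}.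
  have : {ae P, forall w, forall n, if unpickle n is Some q then
      E (ratr q) w <-> S q else True}.
    apply: ae_foralln => n.
    by case: (unpickle n : option rat) => [q|]; [exact: aeE|exact: aeW].
  by apply: filterS => w Ew q; have := Ew (pickle q); rewrite pickleK.
apply: filterS3 aeE J_eq J_gtNy => w Ew /(_ 0%N (leq0n T)) Jw.
move=> /(_ 0%N (leq0n T)) JNy; apply/eqP; rewrite eq_le; apply/andP; split.
  apply/ereal_infP => _ [q /Ew[[x u] le_q] <-].
  apply: le_trans (_ : J 0%N x w <= _).
    by apply: ereal_inf_lbound; exists x.
  by apply: le_trans le_q; rewrite Jw; apply: ereal_inf_lbound; exists u.
apply/ereal_infP => _ [x _ <-].
rewrite Jw; apply/ereal_infP => _ [u _ <-].
rewrite leNgt; apply/negP => lt_inf.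
(* The value is real: [J_gtNy] excludes [-oo], and being below the infimum excludes [+oo]. A
   rational strictly between the two would lie in [S] and below its infimum. *)
have [r pre_r lt_r] : exists2 r : R, pre_value 0 (x, u) w <= r%:E &
    r%:E < ereal_inf [set (ratr q)%:E | q in S].
  have : -oo < pre_value 0 (x, u) w.
    apply: lt_le_trans (JNy x) _; rewrite Jw.
    by apply: ereal_inf_lbound; exists u.
  move: lt_inf; case: (pre_value 0 (x, u) w) => [r ? _|| //].
    by exists r.
  by rewrite ltNge leey.
have [q [rq q_lt]] : exists q : rat, (r < ratr q)%R /\
    (ratr q : R)%:E < ereal_inf [set (ratr q : R)%:E | q in S].
  move: lt_r; case: (ereal_inf _) => [y| |] // ry.
    have [q] := rat_in_itvoo ry; rewrite in_itv/= => /andP[rq qy].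
    by exists q.
  have [q] := rat_in_itvoo (ltr_pwDr ltr01 (lexx r)).
  by rewrite in_itv/= => /andP[rq _]; exists q; split=> //; exact: ltry.
have Sq : S q.
  apply/Ew; exists (x, u); apply: le_trans pre_r _.
  by rewrite lee_fin ltW.
by move: q_lt; rewrite ltNge => /negP; apply; apply: ereal_inf_lbound; exists q.
Qed.

(** The initial state is selected together with a control, on the [F 0]-measurable epigraph of
    [pre_value 0], and the control is dropped. *)
Lemma select_x0 (c e : R) : (0 < e)%R ->
  {ae P, forall w, ereal_inf (range (J 0%N ^~ w)) = c%:E} ->
  exists x : Omega -> state, rv_wrt (F 0%N) x /\
    {ae P, forall w, J 0%N (x w) w <= (c + e)%:E}.
Proof.
move=> e0 infc; have sF := sigF (leq0n T).
pose Phi (a : R) (z : state * ctrlb) (w : Omega) := (z, a : R^o).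
have bPhi a z : borel_fun (T := g_sigma_algebraType (F 0%N)) (Phi a z).
  exact: borel_cst.
have cPhi a w : continuous (Phi a ^~ w).
  apply: pair_continuous; last exact: cst_continuous.
  by move=> z; exact: cvg_id.
have cD w : closed (epi (pre_value 0 ^~ w)) := @pre_value_closed 0 w (leq0n T).
have cptZ : boundedly_compact (state * ctrlb)%type.
  by apply: boundedly_compact_prod; exact: boundedly_compact_colvec.
have [|z [/(rv_wrtP _ sF) rz zP]] := near_optimal_selection
  sep_xb cptZ (separable_prod sep_xb separable_real)
  (pre_value_random (leq0n T)) cD bPhi cPhi _ e0.
  by move=> a a' u w aa'; rewrite /epi /= => /le_trans; apply; rewrite lee_fin.
exists (fun w => (z w).1); split.
  exact: (rv_wrt_comp sF (@fst_continuous _ _) rz).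
apply: filterS2 infc J_eq => w cw /(_ 0%N (leq0n T)) Jw.
apply: (zP w (fun z => J 0%N z.1 w)).
- move=> a z'; rewrite /epi /=; apply: le_trans; rewrite Jw.
  by apply: ereal_inf_lbound; exists z'.2; case: (z').
- by move=> z'; rewrite -cw; apply: ereal_inf_lbound; exists z'.1.
- move=> a; rewrite -lte_fin -cw => /ereal_inf_lt[_ [x _ <-]].
  rewrite Jw => /ereal_inf_lt[_ [u _ <-] lt_a].
  by exists (x, u); rewrite /epi /=; exact: ltW.
Qed.

(** Excludes [c = -oo], and lets the constant be compared with costs by the lemmas on minorized
    functions. *)
Lemma minorized_inf_J0 c :
  {ae P, forall w, ereal_inf (range (J 0%N ^~ w)) = c} -> minorized P (cst c).
Proof.
move=> infc; split; first exact: measurable_cst.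
have [m [im mle]] := J_minor (leq0n T); exists m; split=> //.
apply: filterS2 mle infc => w mw <- /=.
by apply/ereal_infP => _ [x _ <-].
Qed.

Lemma cost0E (X : nat -> Omega -> state) (Ub : nat -> Omega -> ctrlb)
    (Ua : nat -> Omega -> ctrla) :
  cost P L 0 (J 0%N) X Ub Ua = \int[P]_w J 0%N (X 0%N w) w.
Proof. by apply: eq_integral => w _; rewrite big_ord0 add0e. Qed.

Lemma inf_J0_le (X : nat -> Omega -> state) :
  {ae P, forall w, ereal_inf (range (J 0%N ^~ w)) <= J 0%N (X 0%N w) w}.
Proof. by apply: aeW => w; apply: ereal_inf_lbound; exists (X 0%N w). Qed.

Lemma optimum_value_inf_J0 c :
  {ae P, forall w, ereal_inf (range (J 0%N ^~ w)) = c} ->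
  optimum_value P F L Fd 0 (J 0%N) = c.
Proof.
move=> infc; have mc := minorized_inf_J0 infc.
apply/eqP; rewrite eq_le; apply/andP; split; last first.
  apply/ereal_infP => _ [X [Ub [Ua [[ad _] ->]]]].
  rewrite cost0E -[leLHS](probability_integral_cst P).
  apply: le_minorized_integral => //.
    exact (minorized_J (leq0n T) ad (leqnn 0%N)).
  by apply: filterS2 infc (inf_J0_le X) => w <-.
have := minorized_integral_gtNy mc; rewrite probability_integral_cst.
move: mc infc; case: c => [c| |] // mc infc _; last exact: leey.
apply/lee_addgt0Pr => e e0.
have [x [rx xP]] := select_x0 e0 infc.
have sF := sigF (leq0n T).
(* At horizon [0] only time [0] is constrained and only the state enters the cost, so processes
   constant in time with zero controls serve. *)
apply: le_trans (_ : cost P L 0 (J 0%N) (fun=> x) (fun=> cst 0%R)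
  (fun=> cst 0%R) <= _).
  apply: ereal_inf_lbound; exists (fun=> x), (fun=> cst 0%R), (fun=> cst 0%R).
  split=> //; split; last by apply: aeW => w t; rewrite ltn0.
  by move=> t; rewrite leqn0 => /eqP ->; split=> //; exact: rv_wrt_cst.
rewrite cost0E -EFinD -[leRHS](probability_integral_cst P).
apply: le_minorized_integral => //; last exact: minorized_cst.
apply: (@minorized_J 0 (fun=> x) (fun=> cst 0%R) (fun=> cst 0%R)) => //.
by move=> t; rewrite leqn0 => /eqP ->; split=> //; exact: rv_wrt_cst.
Qed.

(** * Passage from [J T] to the terminal cost [JT] *)

Lemma cost_JT X Ub Ua : adapted F T X Ub Ua ->
  cost P L T JT X Ub Ua = cost P L T (J T) X Ub Ua.
Proof.
move=> ad; have [rX _ _] := ad T (leqnn T).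
have mrun := (minorized_run (leqnn T) ad (leqnn T)).1.
apply: ae_eq_integral => //.
- apply: emeasurable_funD => //; apply: measurable_normal_integrand.
  + exact: separable_matrix.
  + exact: normal_integrand_sub (F_measurable (leqnn T)) JT_normal.
  + exact: rv_wrt_borel (F_measurable (leqnn T)) rX.
- apply: emeasurable_funD => //.
  exact (minorized_J (leqnn T) ad (leqnn T)).1.
- have [_ _ _] := JQ_solution.
  by apply: filterS => w [JTw _] _; rewrite JTw.
Qed.

Lemma optimum_value_JT :
  optimum_value P F L Fd T JT = optimum_value P F L Fd T (J T).
Proof.
by congr ereal_inf; apply/seteqP; split=> _ [X [Ub [Ua [fea ->]]]];
  exists X, Ub, Ua; split=> //; rewrite cost_JT//; exact: fea.1.
Qed.

Lemma bellman_optimum_value s : (s <= T)%N ->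
  optimum_value P F L Fd T JT = optimum_value P F L Fd s (J s).
Proof. by move=> sT; rewrite optimum_value_JT !optimum_value_0. Qed.

(** * Optimality conditions *)

Section optimality.
Variables (X : nat -> Omega -> state) (Ub : nat -> Omega -> ctrlb)
  (Ua : nat -> Omega -> ctrla).
Hypothesis ad : adapted F T X Ub Ua.

Lemma cost_le_horizon s : feasible P F Fd T X Ub Ua -> (s <= T)%N ->
  cost P L s (J s) X Ub Ua <= cost P L T (J T) X Ub Ua.
Proof.
move=> [_ dyn] sT.
suff le_add k : (s + k <= T)%N ->
    cost P L s (J s) X Ub Ua <= cost P L (s + k) (J (s + k)) X Ub Ua.
  by have := le_add (T - s)%N; rewrite subnKC//; exact.
elim: k => [|k IH]; first by rewrite addn0.
rewrite addnS => skT; apply: le_trans (IH (ltnW skT)) _.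
exact (cost_le_next (leqnn T) ad dyn skT).
Qed.

Lemma solves_argmin : solves P F L Fd T JT X Ub Ua ->
  {ae P, forall w, argmin (J 0%N ^~ w) (X 0%N w) /\
    forall t, (t < T)%N ->
      [/\ argmin (fun ub => EQ t (X t w, ub) w) (Ub t w),
          argmin (fun ua => L t (X t w, Ub t w, ua) w +
                     J t.+1 (Fd t (X t w) (Ub t w) ua w) w) (Ua t.+1 w)
        & X t.+1 w = Fd t (X t w) (Ub t w) (Ua t.+1 w) w]}.
Proof.
move=> [fea]; rewrite cost_JT// optimum_value_JT => cost_opt cost_fin.
have dyn := fea.2.
have [c infc] := inf_J0_cst.
have opt0 := optimum_value_inf_J0 infc.
(* Every intermediate cost is squeezed between the common optimum value and the optimal cost at
   horizon [T]. *)
have cost_c s : (s <= T)%N -> cost P L s (J s) X Ub Ua = c.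
  move=> sT; apply/eqP; rewrite eq_le; apply/andP; split.
    rewrite -opt0 -(optimum_value_0 (leqnn T)) -cost_opt.
    exact: cost_le_horizon.
  rewrite -opt0 -(optimum_value_0 sT).
  apply: ereal_inf_lbound; exists X, Ub, Ua; split=> //.
  exact: feasible_sub fea.
have c_fin : c < +oo by rewrite -(cost_c T (leqnn T)).
have J0_argmin : {ae P, forall w, argmin (J 0%N ^~ w) (X 0%N w)}.
  have : {ae P, forall w, cst c w = J 0%N (X 0%N w) w /\ cst c w < +oo}.
    apply: minorized_integral_eq.
    - exact: minorized_inf_J0.
    - exact (minorized_J (leqnn T) ad (leq0n T)).
    - by apply: filterS2 infc (inf_J0_le X) => w <-.
    - by rewrite probability_integral_cst -(cost0E X Ub Ua) cost_c.
    - by rewrite probability_integral_cst.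
  by apply: filterS2 infc => w cw [/= cJ c_lty]; split; rewrite -cJ// cw.
have step_argmin : {ae P, forall w, forall t, (t < T)%N ->
    argmin (fun ub => EQ t (X t w, ub) w) (Ub t w) /\
    argmin (fun ua => L t (X t w, Ub t w, ua) w +
      J t.+1 (Fd t (X t w) (Ub t w) ua w) w) (Ua t.+1 w)}.
  apply: ae_foralln => t; have [tT|tT] := boolP (t < T)%N; last exact: aeW.
  have mJ := minorized_J (leqnn T) ad (ltnW tT).
  have mEQ := minorized_EQ (leqnn T) ad (ltnW tT) tT.
  have mQ := minorized_Q (leqnn T) ad (ltnW tT) tT.
  have mLJ := minorizedD (minorized_L (leqnn T) ad tT)
    (minorized_J (leqnn T) ad tT).
  have mrun := minorized_run (leqnn T) ad (ltnW tT).
  have iEQ := integral_EQ (leqnn T) ad (ltnW tT) tT.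
  have costJ := cost_split (leqnn T) ad (ltnW tT).
  have costLJ := cost_split_last (leqnn T) ad tT.
  rewrite cost_c// in costLJ; rewrite cost_c 1?ltnW// in costJ.
  have J_fin : \int[P]_w J t (X t w) w < +oo.
    rewrite ltNge leye_eq; apply/negP => /eqP Jy; move: c_fin.
    by rewrite costJ Jy addey// gt_eqF// minorized_integral_gtNy.
  (* Finiteness allows the common running cost to be cancelled between [costJ] and [costLJ]. *)
  have run_fin : \int[P]_w (\sum_(r < t) L r (X r w, Ub r w, Ua r.+1 w) w)
      \is a fin_num.
    rewrite fin_real// minorized_integral_gtNy//= ltNge leye_eq.
    apply/negP => /eqP runy; move: c_fin.
    by rewrite costJ runy addye// gt_eqF// minorized_integral_gtNy.
  have LJ_le : \int[P]_w (L t (X t w, Ub t w, Ua t.+1 w) w +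
      J t.+1 (X t.+1 w) w) <= \int[P]_w J t (X t w) w.
    by rewrite -(leeD2lE _ _ run_fin) -costLJ -costJ.
  have J_EQ := integral_J_le_EQ (leqnn T) ad tT.
  have EQ_LJ := integral_EQ_le_step (leqnn T) ad dyn tT.
  have EQ_fin : \int[P]_w EQ t (X t w, Ub t w) w < +oo.
    exact: le_lt_trans (le_trans EQ_LJ LJ_le) J_fin.
  (* The integrals of [J t], [EQ t], [Q t] and [L t] plus [J t.+1] now coincide. Each pointwise
     inequality is thus an almost sure equality: the first gives the condition on [Ub], the second
     that on [Ua]. *)
  have eqJ := minorized_integral_eq mJ mEQ (J_le_EQ X Ub tT)
    (le_trans EQ_LJ LJ_le) J_fin.
  rewrite iEQ in J_EQ EQ_fin.
  have eqQ := minorized_integral_eq mQ mLJ (Q_le_step (leqnn T) dyn tT)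
    (le_trans LJ_le J_EQ) EQ_fin.
  apply: filterS3 (filterI eqJ eqQ) (filterI J_eq Q_eq) dyn.
  move=> w [[JE J_lty] [QE Q_lty]] [/(_ t (ltnW tT) (X t w)) Jw].
  move=> /(_ t tT (X t w) (Ub t w)) Qw /(_ t tT) dw _.
  split; split.
  - by rewrite -JE Jw /pre_value tT.
  - by rewrite -JE.
  - by rewrite -Qw QE /= dw.
  - by move: Q_lty; rewrite QE /= dw.
apply: filterS3 J0_argmin step_argmin dyn => w J0w Sw dw; split=> // t tT.
by have [? ?] := Sw t tT; split=> //; exact: dw.
Qed.

Lemma argmin_solves :
  {ae P, forall w, argmin (J 0%N ^~ w) (X 0%N w) /\
    forall t, (t < T)%N ->
      [/\ argmin (fun ub => EQ t (X t w, ub) w) (Ub t w),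
          argmin (fun ua => L t (X t w, Ub t w, ua) w +
                     J t.+1 (Fd t (X t w) (Ub t w) ua w) w) (Ua t.+1 w)
        & X t.+1 w = Fd t (X t w) (Ub t w) (Ua t.+1 w) w]} ->
  solves P F L Fd T JT X Ub Ua.
Proof.
move=> opt.
have fea : feasible P F Fd T X Ub Ua.
  by split=> //; apply: filterS opt => w [_ Sw] t /Sw[].
have [c infc] := inf_J0_cst.
have opt0 := optimum_value_inf_J0 infc.
(* [argmin] includes finiteness of the attained value, so a single sample point in the almost sure
   event is enough. *)
have c_fin : c < +oo.
  by have [w [<- [[<- +] _]]] := ae_inhabited (filterI infc opt).
(* Forward induction: attained infima make each period's comparison an equality, so the cost keeps
   its initial value. *)
have cost_c s : (s <= T)%N -> cost P L s (J s) X Ub Ua = c.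
  elim: s => [_|t IH tT].
    rewrite cost0E -[RHS](probability_integral_cst P).
    apply: ae_eq_integral => //.
      exact (minorized_J (leqnn T) ad (leq0n T)).1.
    by apply: filterS2 infc opt => w <- [[-> _] _] _.
  have mJ := minorized_J (leqnn T) ad (ltnW tT).
  have mEQ := minorized_EQ (leqnn T) ad (ltnW tT) tT.
  have mQ := minorized_Q (leqnn T) ad (ltnW tT) tT.
  have mLJ := minorizedD (minorized_L (leqnn T) ad tT)
    (minorized_J (leqnn T) ad tT).
  rewrite -(IH (ltnW tT)) (cost_split_last (leqnn T) ad tT).
  rewrite (cost_split (leqnn T) ad (ltnW tT)); congr (_ + _).
  transitivity (\int[P]_w Q t (X t w, Ub t w) w).
    apply: ae_eq_integral => //; [exact: mLJ.1|exact: mQ.1|].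
    apply: filterS2 Q_eq opt => w /(_ t tT (X t w) (Ub t w)) -> [_ /(_ t tT)].
    by move=> [_ [+ _] dw] _; rewrite dw.
  rewrite -(integral_EQ (leqnn T) ad (ltnW tT) tT).
  apply: ae_eq_integral => //; [exact: mEQ.1|exact: mJ.1|].
  apply: filterS2 J_eq opt => w /(_ t (ltnW tT) (X t w)) -> [_ /(_ t tT)].
  by move=> [[+ _] _ _] _; rewrite /pre_value tT.
split=> //; rewrite cost_JT// cost_c//.
by rewrite optimum_value_JT optimum_value_0.
Qed.

End optimality.

End dynamic_programming.

Theorem theorem1 (d : measure_display) (Omega : measurableType d) (R : realType)
    (P : probability Omega R) (T N Mb Ma : nat)
    (F : nat -> set (set Omega))
    (L : nat -> ('cV[R]_N * 'cV[R]_Mb * 'cV[R]_Ma)%type -> Omega -> \bar R)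
    (JT : 'cV[R]_N -> Omega -> \bar R)
    (A : nat -> Omega -> 'M[R]_N) (Bb : nat -> Omega -> 'M[R]_(N, Mb))
    (Ba : nat -> Omega -> 'M[R]_(N, Ma)) (W : nat -> Omega -> 'cV[R]_N)
    (J : nat -> 'cV[R]_N -> Omega -> \bar R)
    (Q EQ : nat -> ('cV[R]_N * 'cV[R]_Mb)%type -> Omega -> \bar R)
    (F_filtration : filtration F T)
    (F0_trivial : forall E, F 0%N E -> P E = 0 \/ P E = 1)
    (L_integrand : forall t, (t < T)%N ->
      [/\ normal_integrand (F t.+1) (L t), convex_integrand (L t)
        & lower_bounded P (L t)])
    (JT_integrand :
      [/\ normal_integrand (F T) JT, convex_integrand JT & lower_bounded P JT])
    (dynamics_measurable : forall t, (t < T)%N ->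
      [/\ rv_wrt (F t.+1) (A t.+1), rv_wrt (F t.+1) (Bb t.+1),
          rv_wrt (F t.+1) (Ba t.+1) & rv_wrt (F t.+1) (W t.+1)])
    (L_recession : forall t, (t < T)%N -> {ae P, forall w,
      dom (L t ^~ w) !=set0 /\
      linear_subspace [set u : 'cV[R]_Ma |
        recession (L t ^~ w) (0%R, 0%R, u) <= 0 /\ Ba t.+1 w *m u = 0%R]})
    (Fd := affine_dynamics A Bb Ba W)
    (JQ_solution : normal_bellman_solution P F L Fd T JT J Q EQ)
    (J_convex : forall t, (t <= T)%N ->
      convex_integrand (J t) /\ lower_bounded P (J t))
    (Q_convex : forall t, (t < T)%N ->
      convex_integrand (Q t) /\ lower_bounded P (Q t)) :
  (forall s, (s <= T)%N ->
    optimum_value P F L Fd T JT = optimum_value P F L Fd s (J s)) /\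
  (forall (X : nat -> Omega -> 'cV[R]_N) (Ub : nat -> Omega -> 'cV[R]_Mb)
      (Ua : nat -> Omega -> 'cV[R]_Ma),
    adapted F T X Ub Ua ->
    (solves P F L Fd T JT X Ub Ua <->
     {ae P, forall w,
       argmin (J 0%N ^~ w) (X 0%N w) /\
       forall t, (t < T)%N ->
         [/\ argmin (fun ub => EQ t (X t w, ub) w) (Ub t w),
             argmin (fun ua => L t (X t w, Ub t w, ua) w +
                       J t.+1 (Fd t (X t w) (Ub t w) ua w) w) (Ua t.+1 w)
           & X t.+1 w = Fd t (X t w) (Ub t w) (Ua t.+1 w) w]})).
Proof.
have L_normal t : (t < T)%N -> normal_integrand (F t.+1) (L t).
  by move=> /L_integrand[].
have L_minor t : (t < T)%N -> lower_bounded P (L t).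
  by move=> /L_integrand[].
have [JT_normal _ _] := JT_integrand.
have J_minor t : (t <= T)%N -> lower_bounded P (J t) by move=> /J_convex[].
have Q_minor t : (t < T)%N -> lower_bounded P (Q t) by move=> /Q_convex[].
split.
  move=> s sT; exact: (bellman_optimum_value F_filtration _ _ _ _ JQ_solution).
move=> X Ub Ua ad; split.
  exact: (solves_argmin F_filtration _ _ _ _ _ JQ_solution).
exact: (argmin_solves F_filtration _ _ _ _ _ JQ_solution).
Qed.
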